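(* Let $T$ be a bounded linear operator on a complex Banach space $X$, and let $K$ be a component of the spectrum $\sigma(T)$ which is closed and open in $\sigma(T)$ and such that $K\subset\{z\in\mathbb{C}:|z|\le 1\}$ and $A=K\cap\mathbb{T}$ is a finite set $A=\{e^{i\alpha_1},\dots,e^{i\alpha_m}\}$ with $\alpha_1,\dots,\alpha_m\in\mathbb{R}$. Then the following hold. (1) If there are some $n\in\mathbb{N}$ and $r\in\mathbb{R}$ such that $\alpha_1 n+r,\dots,\alpha_m n+r$ are linearly independent over the field of rationals, then $T$ is not frequently hypercyclic. (2) If for every choice of integers $c_1,\dots,c_m$ with $\sum_{j=1}^m c_j=0$ and $\sum_{j=1}^m c_j\alpha_j=0$ it follows that $c_1=c_2=\dots=c_m=0$, then $T$ is not frequently hypercyclic. (3) If $A$ contains at most two elements, then $T$ is not frequently hypercyclic. (4) If $\alpha_1/\pi,\dots,\alpha_m/\pi$ are rational, then $T$ is not frequently hypercyclic.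
   Context: $\mathbb{T}=\{z\in\mathbb{C}:|z|=1\}$. The lower density of a discrete set $\Lambda\subset\mathbb{C}$ is $\underline{\mathrm{dens}}(\Lambda)=\liminf_{r\to\infty}\#\{\lambda\in\Lambda:|\lambda|\le r\}/r$. A bounded operator $T$ on a Banach space $X$ is frequently hypercyclic if there exists $x\in X$ such that for every non-empty open set $U\subset X$ the set $\{n\in\mathbb{N}:T^nx\in U\}$ has positive lower density. Real numbers $\beta_1,\dots,\beta_m$ are linearly independent over the field of rationals if $c_1\beta_1+\dots+c_m\beta_m=0$ with $c_1,\dots,c_m\in\mathbb{Z}$ implies $c_1=\dots=c_m=0$. *)

(* Defs.v *)
From HB Require Import structures.
From mathcomp Require Import all_boot all_order all_algebra.
From mathcomp Require Import all_classical all_reals all_analysis.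
From mathcomp Require Import complex.

Set Implicit Arguments.
Unset Strict Implicit.
Unset Printing Implicit Defensive.

Import Order.TTheory GRing.Theory Num.Theory.
Import numFieldNormedType.Exports.

Local Open Scope classical_set_scope.
Local Open Scope ring_scope.

(* The library puts the topology of the norm on [F^o] for any numFieldType [F],
   but not on the concrete type [R[i]]. *)
HB.instance Definition _ (R : realType) := NormedModule.copy R[i] R[i]^o.

(* The point $e^{ia}$ of the unit circle. *)
Definition cis (R : realType) (a : R) : R[i] := Complex (cos a) (sin a).

Definition unit_circle (R : realType) : set R[i] := [set z : R[i] | `|z| = 1].

(* liminf, as the real number r tends to +oo, of #{z in L : |z| <= r} / r.
   [counting] is +oo on infinite sets, so that L is not required to be
   discrete. *)
Definition lower_density (R : realType) (L : set R[i]) : \bar R :=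
  limf_einf
    (fun r : R =>
       counting (L `&` [set z : R[i] | `|z| <= r%:C%C]%R) * (r^-1)%:E)%E
    (pinfty_nbhs R).

(* Boundedness near 0; by [linear_boundedP] this is |T x| <= M |x| for all x,
   for some constant M. *)
Definition bounded_operator (R : realType) (X : completeNormedModType R[i])
    (T : {linear X -> X}) : Prop :=
  bounded_near T (nbhs (0 : X)).

Definition resolvent_set (R : realType) (X : completeNormedModType R[i])
    (T : {linear X -> X}) : set R[i] :=
  [set z | exists2 S : {linear X -> X}, bounded_operator S &
     cancel (fun x => T x - z *: x) S /\ cancel S (fun x => T x - z *: x)].

Definition spectrum (R : realType) (X : completeNormedModType R[i])
    (T : {linear X -> X}) : set R[i] :=
  ~` resolvent_set T.

Definition frequently_hypercyclic (R : realType)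
    (X : completeNormedModType R[i]) (T : {linear X -> X}) : Prop :=
  exists x : X, forall U : set X, open U -> U !=set0 ->
    (0 < lower_density
           [set (n%:R : R[i]) | n in [set n : nat | U (iter n T x)]])%E.

Definition rat_independent (R : realType) (m : nat) (b : 'I_m -> R) : Prop :=
  forall c : 'I_m -> int,
    \sum_(j < m) (c j)%:~R * b j = 0 -> forall j, c j = 0.

(* Main.v *)
From HB Require Import structures.
Require Import Defs.
From mathcomp Require Import all_boot all_order all_algebra.
From mathcomp Require Import all_classical all_reals all_analysis.
From mathcomp Require Import finmap complex ring lra zify.

Set Implicit Arguments.
Unset Strict Implicit.
Unset Printing Implicit Defensive.

Import Order.TTheory GRing.Theory Num.Theory.
Import numFieldNormedType.Exports.

Local Open Scope classical_set_scope.
Local Open Scope ring_scope.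

Local Notation Re := complex.Re.
Local Notation Im := complex.Im.

(** The conclusion common to the four parts is that of
    [not_frequently_hypercyclic], applied to the list [ws] of the points of [A].
    Let [p] be the product of the factors [X - w] for [w] in [ws], and let [x] be
    a vector with dense orbit.

    A functional adapted to [K].  The Riesz projection [P] of [T] on [K] is, up
    to a constant, the integral of the resolvent around [K].  For every
    polynomial [g], [g(T) P] is the integral of [g] times the resolvent, over a
    contour as close to [K] as desired.  On [K] the factor [z ^ J] is small away
    from the circle and [p] is small near [A]; hence for every [eta] there is [J]
    such that [|p(z) z ^ J| <= eta] near [K], and [p(T) ^ k T ^ (J k) P] is
    [O(eta ^ k)].  Since a point of [K] is in the spectrum, [P <> 0], and
    composing [P] with a continuous functional yields [phi <> 0] such that
    [phi o (p(T) ^ k T ^ (J k))] is [O(eta ^ k)] ([spectral_functional]).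

    Windows of the orbit.  Fix [h].  The sequence [g n = phi (T ^ (J k + n) x)]
    satisfies the recurrence [p(E) ^ k g = 0], [E] being the shift, up to an
    error [O(eta ^ k)] which grows at most geometrically in [n].  With [eta]
    small enough with respect to [h], the sequence [g] differs on [0, h k] by
    less than 1/2 from an exact solution, that is, from a sum of [w ^ n P_w(n)]
    with polynomials [P_w] of degree below [k]
    ([approximate_pattern_visits]).

    Exact solutions are rigid.  A solution [s] of [p(E) ^ k s = 0], with [m] the
    degree of [p], satisfies [c_0(n) s(n) + ... + c_m(n) s(n + m) = 0] with
    polynomials [c_l] of degree at most [m k], not all zero
    ([exists_recurrence]).  If [s(n), s(n + 1), ...] runs through all sign
    patterns of blocks of [m + 1] complex numbers, then one of the blocks is
    opposed to the signs of the [c_l], unless one of these signs changes in the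
    window.  A polynomial of degree [m k] changes sign at most [m k] times, so
    the pattern occurs at most [c k] times, where [c] depends on [m] only
    ([pattern_visits]).

    Conclusion.  The functionals [phi o T ^ t] are linearly independent
    ([interpolation]), so the vectors [y] for which [phi (T ^ t y)] follows the
    pattern contain a ball.  The orbit visits it at most [c k] times
    between [J k] and [(J + h) k], for every [h] and all large [k], with [c]
    independent of [h]: the set of visits has density zero
    ([rare_visits], [not_frequently_hypercyclic]). *)

(** * Linear recurrences with polynomial coefficients *)
Section Moments.
Variable F : fieldType.
Implicit Types (s : nat -> F) (p q : {poly F}).

(** The functional sending ['X^n] to [s n].  Shifting [s] amounts to
    multiplying the argument by ['X]: a linear recurrence for [s] says that this
    functional vanishes on the ideal generated by the characteristic polynomial. *)
Definition moment s q : F := \sum_(i < size q) q`_i * s i.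

Lemma moment_widen n s q : (size q <= n)%N ->
  moment s q = \sum_(i < n) q`_i * s i.
Proof.
move=> le_qn; rewrite /moment (big_ord_widen n (fun i => q`_i * s i)) //.
rewrite big_mkcond /=; apply: eq_bigr => i _; case: ltnP => // le_qi.
by rewrite nth_default // mul0r.
Qed.

Lemma momentD s p q : moment s (p + q) = moment s p + moment s q.
Proof.
pose n := maxn (size p) (size q).
rewrite !(@moment_widen n) ?leq_maxl ?leq_maxr ?size_polyD //.
by rewrite -big_split; apply: eq_bigr => i _; rewrite coefD mulrDl.
Qed.

Lemma momentZ s a q : moment s (a *: q) = a * moment s q.
Proof.
rewrite (@moment_widen (size q)) ?size_scale_leq // mulr_sumr.
by apply: eq_bigr => i _; rewrite coefZ mulrA.
Qed.

Lemma momentB s p q : moment s (p - q) = moment s p - moment s q.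
Proof. by rewrite momentD -scaleN1r momentZ mulN1r. Qed.

Lemma moment_sum s (I : Type) (r : seq I) (E : I -> {poly F}) :
  moment s (\sum_(i <- r) E i) = \sum_(i <- r) moment s (E i).
Proof.
apply: (big_morph (moment s) (momentD s)).
by rewrite /moment size_poly0 big_ord0.
Qed.

Lemma momentXn s n : moment s 'X^n = s n.
Proof.
rewrite /moment size_polyXn big_ord_recr /= coefXn eqxx mul1r.
by rewrite big1 ?add0r // => i _; rewrite coefXn ltn_eqF ?mul0r.
Qed.

Lemma moment_subl s s' q :
  moment (fun n => s n - s' n) q = moment s q - moment s' q.
Proof. by rewrite /moment -sumrB; apply: eq_bigr => i _; rewrite mulrBr. Qed.

Lemma moment_ideal0 s p : (forall n, moment s (p * 'X^n) = 0) ->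
  forall q, moment s (p * q) = 0.
Proof.
move=> p0 q; rewrite -[q]coefK poly_def mulr_sumr moment_sum big1 // => i _.
by rewrite -scalerAr momentZ p0 mulr0.
Qed.

(** This operator multiplies ['X^n] by [n]; composing with it turns the moment
    functional of [s n] into that of [n * s n]. *)
Definition euler q := 'X * q^`().

Lemma eulerD p q : euler (p + q) = euler p + euler q.
Proof. by rewrite /euler derivD mulrDr. Qed.

Lemma eulerZ a q : euler (a *: q) = a *: euler q.
Proof. by rewrite /euler derivZ scalerAr. Qed.

Lemma iter_eulerD i p q : iter i euler (p + q) = iter i euler p + iter i euler q.
Proof. by elim: i => //= i ->; rewrite eulerD. Qed.

Lemma iter_eulerZ i a q : iter i euler (a *: q) = a *: iter i euler q.
Proof. by elim: i => //= i ->; rewrite eulerZ. Qed.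

Lemma iter_eulerXn i n : iter i euler 'X^n = (n%:R ^+ i) *: 'X^n.
Proof.
have e1 : euler 'X^n = n%:R *: 'X^n.
  rewrite /euler derivXn; case: n => [|n]; first by rewrite mulr0n mulr0 scale0r.
  by rewrite mulrnAr -exprS scaler_nat.
elim: i => [|i IH] /=; first by rewrite expr0 scale1r.
by rewrite IH eulerZ e1 scalerA exprSr.
Qed.

(** A derivation lowers the power of [p] by at most one. *)
Lemma iter_euler_ideal i N p q :
  exists q', iter i euler (p ^+ (N + i) * q) = p ^+ N * q'.
Proof.
elim: i N q => [|i IH] N q; first by exists q; rewrite addn0.
have [q' /= E] := IH N.+1 q; rewrite addSnnS in E; rewrite /= E.
exists ('X * (p^`() *+ N.+1 * q' + p * q'^`())).
rewrite /euler derivM deriv_exp /= exprSr.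
by rewrite -!(mulr_natr (_ * _)) -(mulr_natr p^`()); ring.
Qed.

(** The functionals ['X^n |-> n ^ i * s (n + l)] with [l <= m] and [i <= m * k]
    all vanish on the ideal of [p ^+ (k + m * k)], hence belong to a space of
    dimension [m * (k + m * k)].  There are [m.+1 * (m * k).+1] of them, which is
    larger, so they are linearly dependent. *)
Lemma exists_recurrence m k s p : p \is monic -> size p = m.+1 ->
    (forall q, moment s (p ^+ k * q) = 0) ->
  exists c : 'I_m.+1 -> {poly F},
    [/\ exists l, c l != 0, forall l, (size (c l) <= (m * k).+1)%N
      & forall n, \sum_l (c l).[n%:R] * s (n + l)%N = 0].
Proof.
move=> p_monic sz_p pk0; pose D := (m * k).+1; pose K := (k + m * k)%N.
pose A := \matrix_(r < m.+1 * D, n < m * K)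
   let: (l, i) := enum_val (cast_ord (esym (mxvec_cast m.+1 D)) r) in
   n%:R ^+ i * s (n + l)%N : F.
have AE l i n : A (mxvec_index l i) n = n%:R ^+ i * s (n + l)%N.
  by rewrite mxE /mxvec_index cast_ordK enum_rankK.
have /rowV0Pn[v /sub_kermxP vA v_neq0] : kermx A != 0.
  rewrite -mxrank_eq0 mxrank_ker subn_eq0 -ltnNge.
  by apply: leq_ltn_trans (rank_leq_col A) _; rewrite /K /D; nia.
pose V : 'M[F]_(m.+1, D) := vec_mx v.
have V_neq0 : V != 0 by rewrite vec_mx_eq0.
pose c l := \poly_(i < D) V l (inord i).
have cE l x : (c l).[x] = \sum_(i < D) V l i * x ^+ i.
  by rewrite horner_poly; apply: eq_bigr => i _; rewrite inord_val.
pose Lam q := \sum_l \sum_(i < D) V l i * moment s ('X^l * iter i euler q).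
have LamD q q' : Lam (q + q') = Lam q + Lam q'.
  rewrite -big_split; apply: eq_bigr => l _; rewrite -big_split.
  by apply: eq_bigr => i _; rewrite iter_eulerD mulrDr momentD mulrDr.
have LamZ a q : Lam (a *: q) = a * Lam q.
  rewrite mulr_sumr; apply: eq_bigr => l _; rewrite mulr_sumr.
  by apply: eq_bigr => i _; rewrite iter_eulerZ -scalerAr momentZ mulrCA.
have LamXn n : Lam 'X^n = \sum_l (c l).[n%:R] * s (n + l)%N.
  apply: eq_bigr => l _; rewrite cE mulr_suml; apply: eq_bigr => i _.
  by rewrite iter_eulerXn -scalerAr momentZ -exprD momentXn mulrA addnC.
have Lam_ideal q : Lam (p ^+ K * q) = 0.
  rewrite /Lam big1 // => l _; rewrite big1 // => i _.
  have le_i : (i <= m * k)%N by rewrite -ltnS.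
  have -> : K = (k + (m * k - i) + i)%N by rewrite /K; lia.
  have [q' ->] := iter_euler_ideal i (k + (m * k - i)) p q.
  by rewrite mulrCA exprD -mulrA pk0 mulr0.
have Lam_low n : (n < m * K)%N -> Lam 'X^n = 0.
  move=> ltn; have := congr1 (fun M : 'rV_ _ => M 0 (Ordinal ltn)) vA.
  rewrite [LHS]mxE [RHS]mxE => vAn; rewrite LamXn -[RHS]vAn.
  rewrite (reindex _ (curry_mxvec_bij _ _)) /=.
  under eq_bigr do rewrite cE mulr_suml.
  rewrite pair_bigA /=; apply: eq_bigr => -[l i] _ /=.
  by rewrite AE /= [V l i]mxE mulrA.
exists c; split.
- have /matrix0Pn[l [i Vli]] := V_neq0.
  exists l; apply: contraNneq Vli => /(congr1 (fun q : {poly F} => q`_i)).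
  by rewrite coef_poly ltn_ord inord_val coef0 => ->.
- by move=> l; apply: size_poly.
move=> n; rewrite -LamXn.
have pK_monic : p ^+ K \is monic by apply: monic_exp.
have sz_pK : size (p ^+ K) = (m * K).+1.
  by rewrite -[LHS]prednK ?size_exp ?sz_p // size_poly_gt0 monic_neq0.
have pK_neq0 := monic_neq0 pK_monic.
rewrite (divp_eq 'X^n (p ^+ K)) LamD mulrC Lam_ideal add0r.
have := ltn_modpN0 'X^n pK_neq0; rewrite sz_pK ltnS; set r := _ %% _ => sz_r.
rewrite -[r]coefK poly_def (big_morph Lam LamD (_ : Lam 0 = 0)).
  by rewrite big1 // => i _; rewrite LamZ Lam_low ?mulr0 // (leq_trans _ sz_r).
by rewrite -(scale0r 0) LamZ mul0r.
Qed.
End Moments.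

(** * Sign patterns in exponential polynomials *)
Section SignPatterns.
Local Open Scope complex_scope.
Variable R : rcfType.

(** The window [[n, n + w]] is determined by a root in it and by the class of [n]
    modulo [w.+1]. *)
Lemma root_windows_count (q : {poly R}) (w : nat) (ns : seq nat) :
    q != 0 -> uniq ns ->
    (forall n, n \in ns -> exists x, root q x && (n%:R <= x <= (n + w)%:R)) ->
  (size ns <= w.+1 * size q)%N.
Proof.
move=> q0 uns rt.
pose f n := if n \in ns =P true is ReflectT h then xchoose (rt n h) else 0.
have fP n : n \in ns -> root q (f n) && (n%:R <= f n <= (n + w)%:R).
  by rewrite /f; case: eqP => // h _; exact: (xchooseP (rt n h)).
pose rs := undup (map f ns).
have szrs : (size rs < size q)%N.
  apply: max_poly_roots; rewrite ?undup_uniq //.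
  by apply/allP => x; rewrite mem_undup => /mapP[n /fP/andP[? _] ->].
pose g n := (f n, n %% w.+1)%N.
have g_inj : {in ns &, injective g}.
  move=> n n' /fP/andP[_ /andP[h1 h2]] /fP/andP[_ /andP[h3 h4]] [ff].
  move: h3 h4; rewrite -ff => h3 h4 nn.
  have := le_trans h1 h4; have := le_trans h3 h2; rewrite !ler_nat => l1 l2.
  have := divn_eq n w.+1; have := divn_eq n' w.+1; rewrite nn.
  by case: (ltngtP (n %/ w.+1)%N (n' %/ w.+1)%N) => [lt|lt|-> <- //];
    have := leq_mul lt (leqnn w.+1); lia.
have : (size (map g ns) <= size [seq (x, y) | x <- rs, y <- iota 0 w.+1])%N.
  apply: uniq_leq_size; first by rewrite map_inj_in_uniq.
  move=> y /mapP[n nns ->]; apply: allpairs_f; last by rewrite mem_iota /= add0n ltn_mod.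
  by rewrite mem_undup; apply: map_f.
rewrite size_map size_allpairs size_iota mulnC => h.
by apply: leq_trans h _; rewrite leq_mul2l ltnW.
Qed.

Lemma same_sign_without_root (q : {poly R}) (a b x : R) :
    (forall z, a <= z <= b -> ~~ root q z) -> a <= x <= b ->
  0 < q.[a] * q.[x].
Proof.
move=> nr /andP[ax xb].
have nza : q.[a] != 0 by apply: (nr a); rewrite lexx (le_trans ax xb).
have nzx : q.[x] != 0 by apply: (nr x); rewrite ax xb.
rewrite ltNge; apply/negP => qq.
have rt (p : {poly R}) : p.[a] <= 0 <= p.[x] -> (forall z, root p z -> root q z) -> False.
  move=> /(poly_ivt ax)[z /andP[z1 z2] pz] /(_ z pz).
  by apply/negP/nr; rewrite z1 (le_trans z2).
case: (leP q.[a] 0) => [qa|qa].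
  apply: (rt q) => //; rewrite qa /=.
  have qa' : q.[a] < 0 by rewrite lt_neqAle nza.
  by rewrite leNgt; apply/negP => qx; move: qq; rewrite leNgt nmulr_rgt0 // qx.
apply: (rt (- q)); last by move=> z; rewrite rootN.
rewrite !hornerN oppr_le0 (ltW qa) oppr_ge0 /=.
by move: qq; rewrite pmulr_rle0.
Qed.

Local Notation C := R[i].

Definition re_poly (p : {poly C}) : {poly R} := \poly_(i < size p) Re p`_i.
Definition im_poly (p : {poly C}) : {poly R} := \poly_(i < size p) Im p`_i.

Lemma complex_natE n : n%:R = (n%:R : R)%:C :> C.
Proof. by rewrite rmorph_nat. Qed.

Lemma ReD (x y : C) : Re (x + y) = Re x + Re y. Proof. by case: x y => [? ?] [? ?]. Qed.
Lemma ImD (x y : C) : Im (x + y) = Im x + Im y. Proof. by case: x y => [? ?] [? ?]. Qed.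
Lemma ReM (x y : C) : Re (x * y) = Re x * Re y - Im x * Im y.
Proof. by case: x y => [? ?] [? ?]. Qed.

Lemma Re_sum (I : finType) (E : I -> C) : Re (\sum_i E i) = \sum_i Re (E i).
Proof. exact: (big_morph (@Re R) ReD (erefl _)). Qed.
Lemma Im_sum (I : finType) (E : I -> C) : Im (\sum_i E i) = \sum_i Im (E i).
Proof. exact: (big_morph (@Im R) ImD (erefl _)). Qed.

Lemma re_im_horner (p : {poly C}) n :
  p.[n%:R] = (re_poly p).[n%:R] +i* (im_poly p).[n%:R].
Proof.
apply/eqP; rewrite eq_complex /= horner_coef Re_sum Im_sum !horner_poly.
have E (a : C) i : a * n%:R ^+ i = (Re a * n%:R ^+ i) +i* (Im a * n%:R ^+ i).
  by rewrite complex_natE -rmorphXn /=; case: a => a b; simpc.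
by apply/andP; split; apply/eqP/eq_bigr => i _; rewrite E.
Qed.

Lemma re_im_poly_eq0 (p : {poly C}) : re_poly p = 0 -> im_poly p = 0 -> p = 0.
Proof.
move=> r0 i0; apply/polyP => j; rewrite coef0.
have := congr1 (fun q : {poly R} => q`_j) r0; have := congr1 (fun q : {poly R} => q`_j) i0.
rewrite !coef_poly !coef0; case: ltnP => [_ h1 h2|h _ _]; last by rewrite nth_default.
by apply/eqP; rewrite eq_complex h1 h2 !eqxx.
Qed.

Definition sign_patterns m := enum {ffun 'I_m.+1 -> bool * bool}.
Definition pattern_length m := (size (sign_patterns m) * m.+1)%N.
(** A pair of signs, for the real and the imaginary part, is prescribed at each
    time [t]; consecutive blocks of length [m.+1] run through all assignments of
    such pairs to the indices below [m.+1]. *)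
Definition pattern m t : bool * bool :=
  nth [ffun=> (false, false)] (sign_patterns m) (t %/ m.+1)
    (inord (t %% m.+1)).

Lemma patternP m (f : {ffun 'I_m.+1 -> bool * bool}) :
  exists2 i, (i * m.+1 + m.+1 <= pattern_length m)%N
    & forall l : 'I_m.+1, pattern m (i * m.+1 + l)%N = f l.
Proof.
have f_in : f \in sign_patterns m by rewrite mem_enum.
exists (index f (sign_patterns m)).
  by rewrite -mulSnr leq_mul2r index_mem f_in orbT.
move=> l; rewrite /pattern divnMDl // divn_small // addn0 modnMDl modn_small //.
by rewrite nth_index // inord_val.
Qed.

Definition follows_pattern m (s : nat -> C) n := forall t, (t < pattern_length m)%N ->
  0 < (-1) ^+ (pattern m t).1 * Re (s (n + t)%N) /\
  0 < (-1) ^+ (pattern m t).2 * Im (s (n + t)%N).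

Lemma sign_transfer (a a' r : R) :
  0 < a * a' -> 0 < (-1) ^+ (a < 0)%R * r -> 0 < a' * r.
Proof.
case: (ltP a 0) => [a_lt0 aa'|a_ge0 aa'].
  rewrite nmulr_rgt0 // in aa'.
  by rewrite expr1 mulN1r oppr_gt0 => r_lt0; rewrite nmulr_rgt0.
have a_gt0 : 0 < a by rewrite lt_neqAle a_ge0 andbT; apply: contraTneq aa' => <-; rewrite mul0r ltxx.
rewrite pmulr_rgt0 // in aa'.
by rewrite expr0 mul1r => r_gt0; rewrite pmulr_rgt0.
Qed.

(** In the relation of [exists_recurrence], as long as the real and imaginary
    parts of the coefficients keep their signs, one of the blocks of the pattern
    gives a nonnegative real part to every term, and a positive one to some of
    them.  Hence each visit forces a root of one of these real polynomials in the
    window. *)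
Lemma pattern_visits m k s p ns : p \is monic -> size p = m.+1 ->
    (forall q, moment s (p ^+ k * q) = 0) -> uniq ns ->
    (forall n, n \in ns -> follows_pattern m s n) ->
  (size ns <= (pattern_length m).+1 * (2 * m.+1 * (m * k).+1).+1)%N.
Proof.
move=> p_monic sz_p pk0 uns vis.
have [c [[l0 cl0] c_size c_rel]] := exists_recurrence p_monic sz_p pk0.
(* Zero polynomials keep their sign and are left out of the product [Q]. *)
pose nz (q : {poly R}) := if q == 0 then 1 else q.
have nz_neq0 q : nz q != 0 by rewrite /nz; case: (eqVneq q 0) => // _; exact: oner_neq0.
pose Q := \prod_l (nz (re_poly (c l)) * nz (im_poly (c l))).
have Q_neq0 : Q != 0 by apply/prodf_neq0 => l _; rewrite mulf_neq0.
have Q_size : (size Q <= (2 * m.+1 * (m * k).+1).+1)%N.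
  have sz l : (size (nz (re_poly (c l)) * nz (im_poly (c l)))%R <= (2 * (m * k).+1).+1)%N.
    have h (q : {poly R}) : (size q <= size (c l))%N -> (size (nz q) <= (m * k).+1)%N.
      rewrite /nz; case: eqP => _; first by rewrite size_poly1.
      by move=> /leq_trans; apply; apply: c_size.
    have h1 := h _ (size_poly _ (fun i => Re (c l)`_i)).
    have h2 := h _ (size_poly _ (fun i => Im (c l)`_i)).
    by apply: leq_trans (size_polyMleq _ _) _; rewrite -/(re_poly _) -/(im_poly _) in h1 h2 *; lia.
  apply: leq_trans (size_poly_prod_leq _ _) _.
  have : (\sum_(l : 'I_m.+1) size (nz (re_poly (c l)) * nz (im_poly (c l)))%R
    <= \sum_(l : 'I_m.+1) (2 * (m * k).+1).+1)%N by apply: leq_sum.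
  rewrite sum_nat_const (_ : #|'I_m.+1| = m.+1) ?card_ord //.
  by move=> h; rewrite leq_subLR; apply: leq_ltn_trans h _; lia.
suff rt n : n \in ns -> exists x, root Q x && (n%:R <= x <= (n + pattern_length m)%:R).
  apply: leq_trans (root_windows_count Q_neq0 uns rt) _.
  by rewrite leq_mul2l Q_size orbT.
move=> nns; have vn := vis n nns.
have [|no_root] := EM (exists x, root Q x && (n%:R <= x <= (n + pattern_length m)%:R)); first by [].
have no_root' (q : {poly R}) (x : R) : nz q %| Q -> n%:R <= x <= (n + pattern_length m)%:R -> ~~ root (nz q) x.
  move=> dvd xw; apply/negP => rx; apply: no_root; exists x.
  rewrite xw andbT; move: rx; rewrite -!dvdp_XsubCl => /dvdp_trans; exact.
have dvd_re l : nz (re_poly (c l)) %| Q.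
  by rewrite /Q (bigD1 l) //= -mulrA dvdp_mulr.
have dvd_im l : nz (im_poly (c l)) %| Q.
  by rewrite /Q (bigD1 l) //= mulrAC dvdp_mull.
pose f : {ffun 'I_m.+1 -> bool * bool} := [ffun l => ((re_poly (c l)).[n%:R] < 0, 0 < (im_poly (c l)).[n%:R])].
(* [f] holds the signs of the conjugates of the coefficients at [n]. *)
have [i iw fE] := patternP f.
pose n' := (n + i * m.+1)%N.
have n'w : n%:R <= (n'%:R : R) <= (n + pattern_length m)%:R.
  by rewrite !ler_nat /n'; lia.
have sgn (q : {poly R}) : nz q %| Q -> q != 0 -> 0 < q.[n%:R] * q.[n'%:R].
  move=> dvd q0; apply: (@same_sign_without_root _ _ (n + pattern_length m)%:R) => //.
  by move=> z zw; have := no_root' q z dvd zw; rewrite /nz (negPf q0).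
have := congr1 (@Re R) (c_rel n'); rewrite Re_sum.
pose T1 l := (re_poly (c l)).[n'%:R] * Re (s (n' + l)%N).
pose T2 l := - ((im_poly (c l)).[n'%:R] * Im (s (n' + l)%N)).
have -> : \sum_l Re ((c l).[n'%:R] * s (n' + l)%N) = \sum_l (T1 l + T2 l).
  by apply: eq_bigr => l _; rewrite ReM re_im_horner.
have vs (l : 'I_m.+1) : (i * m.+1 + l < pattern_length m)%N.
  by have := ltn_ord l; lia.
have pos1 l : re_poly (c l) != 0 -> 0 < T1 l.
  move=> q0; have [+ _] := vn _ (vs l); rewrite fE ffunE addnA /=.
  exact: sign_transfer (sgn _ (dvd_re l) q0).
have pos2 l : im_poly (c l) != 0 -> 0 < T2 l.
  move=> q0; have [_] := vn _ (vs l); rewrite fE ffunE addnA /= -(oppr_lt0 (im_poly (c l)).[n%:R]) /T2 -mulNr.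
  by apply: sign_transfer; rewrite mulrNN; exact: sgn.
have ge1 l : 0 <= T1 l.
  by have [q0|/pos1/ltW//] := eqVneq (re_poly (c l)) 0; rewrite /T1 q0 horner0 mul0r.
have ge2 l : 0 <= T2 l.
  by have [q0|/pos2/ltW//] := eqVneq (im_poly (c l)) 0; rewrite /T2 q0 horner0 mul0r oppr0.
rewrite (bigD1 l0) //= => S0.
have S_ge0 : 0 <= \sum_(l | l != l0) (T1 l + T2 l) by apply: sumr_ge0 => l _; rewrite addr_ge0.
have [r0|/pos1] := eqVneq (re_poly (c l0)) 0; last by have := ge2 l0; lra.
have [i0|/pos2] := eqVneq (im_poly (c l0)) 0; last by have := ge1 l0; lra.
by rewrite (re_im_poly_eq0 r0 i0) eqxx in cl0.
Qed.
End SignPatterns.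

(** * The norm as a real number *)
Section RealNorm.
Local Open Scope complex_scope.
Variable R : rcfType.
Local Notation C := R[i].

(** The norm of a complex normed space has its values in [R[i]], which is only
    partially ordered; its real part is the same number seen in [R]. *)
Definition nrm (V : normedZmodType C) (v : V) : R := Re `|v|.

Section ZmodNorm.
Local Open Scope complex_scope.
Variable V : normedZmodType C.
Implicit Types u v : V.

Lemma normE v : `|v| = (nrm v)%:C.
Proof. by rewrite /nrm RRe_real // normr_real. Qed.

Lemma nrm_ge0 v : 0 <= nrm v.
Proof. by rewrite -ler0c -normE. Qed.

Lemma nrmD u v : nrm (u + v) <= nrm u + nrm v.
Proof. by rewrite -lecR rmorphD /= -!normE ler_normD. Qed.

Lemma nrmN v : nrm (- v) = nrm v.
Proof. by rewrite /nrm normrN. Qed.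

Lemma nrm0 : nrm (0 : V) = 0.
Proof. by rewrite /nrm normr0. Qed.

Lemma nrm_eq0 v : nrm v = 0 -> v = 0.
Proof. by move=> v0; apply/eqP; rewrite -normr_eq0 normE v0. Qed.

Lemma nrmB u v : nrm (u - v) <= nrm u + nrm v.
Proof. by rewrite -(nrmN v) nrmD. Qed.

Lemma nrm_distC u v : nrm (u - v) = nrm (v - u).
Proof. by rewrite -nrmN opprB. Qed.

Lemma nrm_triangle w u v : nrm (u - v) <= nrm (u - w) + nrm (w - v).
Proof. by have := nrmD (u - w) (w - v); rewrite addrA subrK. Qed.

Lemma nrm_sum (I : Type) (r : seq I) (P : pred I) (E : I -> V) :
  nrm (\sum_(i <- r | P i) E i) <= \sum_(i <- r | P i) nrm (E i).
Proof.
elim/big_rec2: _ => [|i y x _ le_xy]; first by rewrite nrm0.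
by apply: le_trans (nrmD _ _) _; rewrite lerD2l.
Qed.
End ZmodNorm.

Implicit Types x y z : C.

Lemma nrmM x y : nrm (x * y) = nrm x * nrm y.
Proof. by apply/complexI; rewrite rmorphM /= -!normE normrM. Qed.

Lemma nrm1 : nrm (1 : C) = 1.
Proof. by rewrite /nrm normr1. Qed.

Lemma nrmX x n : nrm (x ^+ n) = nrm x ^+ n.
Proof. by elim: n => [|n IH]; rewrite ?expr0 ?nrm1 // !exprS nrmM IH. Qed.

Lemma nrmV x : nrm x^-1 = (nrm x)^-1.
Proof. by apply/complexI; rewrite -normE normfV normE fmorphV. Qed.

Lemma nrm_real (a : R) : nrm (a%:C) = `|a|.
Proof. by rewrite /nrm normc_def /= expr0n addr0 sqrtr_sqr. Qed.

Lemma nrm_def z : nrm z = Num.sqrt (Re z ^+ 2 + Im z ^+ 2).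
Proof. by rewrite /nrm normc_def. Qed.

Lemma nrm_Re z : `|Re z| <= nrm z.
Proof. by rewrite nrm_def -sqrtr_sqr ler_wsqrtr // lerDl sqr_ge0. Qed.

Lemma nrm_Im z : `|Im z| <= nrm z.
Proof. by rewrite nrm_def -sqrtr_sqr ler_wsqrtr // lerDr sqr_ge0. Qed.

Lemma nrm_ReIm z : nrm z <= `|Re z| + `|Im z|.
Proof.
rewrite {1}[z]complexE; apply: le_trans (nrmD _ _) _.
have nrmi : nrm ('i : C) = 1 by rewrite nrm_def /= expr0n add0r expr1n sqrtr1.
by rewrite nrmM nrmi mul1r !nrm_real.
Qed.
End RealNorm.

(** * Approximate solutions of linear recurrences *)
Section Perturbation.
Local Open Scope complex_scope.
Variable R : rcfType.
Local Notation C := R[i].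

Definition root_poly (ws : seq C) : {poly C} := \prod_(w <- ws) ('X - w%:P).

Lemma root_poly_cons w ws : root_poly (w :: ws) = ('X - w%:P) * root_poly ws.
Proof. by rewrite /root_poly big_cons. Qed.

Lemma root_poly_nseq ws k : root_poly (flatten (nseq k ws)) = root_poly ws ^+ k.
Proof.
elim: k => [|k IH] /=; first by rewrite /root_poly big_nil expr0.
by rewrite /root_poly big_cat -/(root_poly _) -/(root_poly _) IH exprS.
Qed.

(** The factors are inverted one at a time, with zero initial value.  As
    [nrm z = 1] and [2 <= B], the recursion [u n.+1 = z * u n + w n] preserves the
    bound: [tau * B ^+ n + tau * B ^+ n <= tau * B ^+ n.+1].  The constant does
    not depend on the number of factors. *)
Lemma solve_recurrence (ws : seq C) (B tau : R) (w : nat -> C) : 2 <= B ->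
    (forall z, z \in ws -> nrm z = 1) ->
    (forall n, nrm (w n) <= tau * B ^+ n) ->
  exists2 v : nat -> C, forall n, nrm (v n) <= tau * B ^+ n
    & forall n, moment v (root_poly ws * 'X^n) = w n.
Proof.
move=> B2; elim: ws w => [|z ws IH] w unim w_le.
  by exists w => // n; rewrite /root_poly big_nil mul1r momentXn.
pose u := fix u n := if n is n'.+1 then z * u n' + w n' else 0.
have tau0 : 0 <= tau by have := le_trans (nrm_ge0 _) (w_le 0%N); rewrite expr0 mulr1.
have u_le n : nrm (u n) <= tau * B ^+ n.
  elim: n => [|n IHn] /=; first by rewrite nrm0 expr0 mulr1.
  have := nrmD (z * u n) (w n); rewrite nrmM (unim z) ?mem_head // mul1r => h.
  have := w_le n; rewrite exprS.
  have : 0 <= tau * B ^+ n by rewrite mulr_ge0 // exprn_ge0 //; lra.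
  by nra.
have [|v v_le vE] := IH u _ u_le.
  by move=> y yw; apply: unim; rewrite in_cons yw orbT.
exists v => // n; rewrite root_poly_cons mulrBl mulrBl momentB.
have -> : 'X * root_poly ws * 'X^n = root_poly ws * 'X^(n.+1) by rewrite exprS; ring.
by rewrite -mulrA mul_polyC momentZ !vE /= addrC addKr.
Qed.

Definition target m t : C :=
  let b := pattern m t in ((-1) ^+ b.1) +i* ((-1) ^+ b.2).

Lemma same_sign_near (b : bool) (x : R) : `|x - (-1) ^+ b| < 1 -> 0 < (-1) ^+ b * x.
Proof. by rewrite ltr_norml; case: b; rewrite ?expr0 ?expr1 => /andP[? ?]; lra. Qed.

Lemma follows_pattern_near m (s : nat -> C) n :
    (forall t, (t < pattern_length m)%N -> nrm (s (n + t)%N - target m t) < 1) ->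
  follows_pattern m s n.
Proof.
move=> near_t t t_lt; have near_nt := near_t t t_lt.
split; apply: same_sign_near; apply: le_lt_trans near_nt.
  apply: le_trans (nrm_Re _); rewrite le_eqVlt; apply/orP; left; apply/eqP.
  by congr `|_|; rewrite /target; case: (s _) => a b.
apply: le_trans (nrm_Im _); rewrite le_eqVlt; apply/orP; left; apply/eqP.
by congr `|_|; rewrite /target; case: (s _) => a b.
Qed.

(** Subtracting from [s] the solution of [solve_recurrence] gives an exact
    solution, and the difference is too small to change the signs in the windows
    that start before [h]. *)
Lemma approximate_pattern_visits (ws : seq C) k (s : nat -> C) (B tau : R) h ns :
    2 <= B -> (forall z, z \in ws -> nrm z = 1) ->
    (forall n, nrm (moment s (root_poly ws ^+ k * 'X^n)) <= tau * B ^+ n) ->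
    tau * B ^+ (h + pattern_length (size ws)) <= 2^-1 -> uniq ns ->
    (forall n, n \in ns -> (n <= h)%N /\
       forall t, (t < pattern_length (size ws))%N ->
         nrm (s (n + t)%N - target (size ws) t) < 2^-1) ->
  (size ns <= (pattern_length (size ws)).+1 *
                (2 * (size ws).+1 * (size ws * k).+1).+1)%N.
Proof.
set m := size ws => B2 unim small_pk tau_small uns vis.
have tau0 : 0 <= tau by have := le_trans (nrm_ge0 _) (small_pk 0%N); rewrite expr0 mulr1.
have unim' z : z \in flatten (nseq k ws) -> nrm z = 1.
  by move=> /flattenP[l /nseqP[-> _]]; apply: unim.
have [v v_le vE] := solve_recurrence B2 unim' small_pk.
apply: (@pattern_visits _ m k (fun n => s n - v n) (root_poly ws)) => //.
- exact: monic_prod_XsubC.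
- by rewrite /root_poly size_prod_XsubC.
- apply: moment_ideal0 => n; rewrite moment_subl.
  by rewrite -[in X in _ - X]root_poly_nseq vE subrr.
move=> n nns; have [n_h near_n] := vis n nns; apply: follows_pattern_near => t t_lt.
have v_small : nrm (v (n + t)%N) <= 2^-1.
  apply: le_trans tau_small; apply: le_trans (v_le _) _; apply: ler_wpM2l => //.
  by apply: ler_weXn2l; [lra | lia].
have := near_n t t_lt; have := nrmB (s (n + t)%N - target m t) (v (n + t)%N).
rewrite addrAC => h1 h2; rewrite [ltRHS]splitr div1r.
by apply: le_lt_trans h1 _; apply: ltr_leD.
Qed.

End Perturbation.

(** * Counting along geometric windows *)

(** In the window starting at [J * k], of length [2 * c * e * k], the set has
    proportion at most [1 / (2 * e)].  A number [n] is the end of such a window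
    up to a bounded error, and one concludes by induction on [n]. *)
Lemma sublinear_count (A : pred nat) (c e : nat) : (0 < c)%N -> (0 < e)%N ->
    (forall h, (0 < h)%N -> exists J k0, forall k, (k0 <= k)%N ->
       (count A (iota (J * k) (h * k)) <= c * k)%N) ->
  exists A0, forall n, (e * count A (iota 0 n) <= A0 + n)%N.
Proof.
move=> c0 e0 wins; have ce_gt0 : (0 < c * e)%N by rewrite muln_gt0 c0 e0.
have [|J [k0 win]] := wins (2 * (c * e))%N; first by rewrite muln_gt0.
pose V n := count A (iota 0 n).
have V_le n : (V n <= n)%N by rewrite -[leqRHS](size_iota 0) count_size.
have V_mono n n' : (n <= n')%N -> (V n <= V n')%N.
  by move=> le_n; rewrite /V -(subnKC le_n) iotaD count_cat leq_addr.
set x := (c * e)%N in ce_gt0 win.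
pose D := (J + 2 * x)%N; pose n0 := ((J + k0).+1 * D)%N.
exists (e * n0)%N; elim/ltn_ind => n IH; rewrite -/(V n).
have [lt_n|le_n] := ltnP n n0.
  apply: leq_trans (leq_addr _ _).
  by rewrite leq_mul2l (leq_trans (V_le n) (ltnW lt_n)) orbT.
have D0 : (0 < D)%N by rewrite /D addn_gt0 muln_gt0 ce_gt0 orbT.
have En := divn_eq n D; set q := (n %/ D)%N in En; set r := (n %% D)%N in En.
have r_lt : (r < D)%N by apply: ltn_pmod.
have q_ge : ((J + k0).+1 <= q)%N by rewrite leq_divRL.
have step : (V n <= V (J * q.+1) + c * q.+1)%N.
  apply: leq_trans (V_mono n (J * q.+1 + 2 * x * q.+1)%N _) _.
    by rewrite -mulnDl -/D {1}En mulnS addnC [(q * D)%N]mulnC leq_add2r ltnW.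
  rewrite /V iotaD count_cat leq_add2l add0n; apply: win.
  by apply: leqW; apply: leq_trans q_ge; apply: leqW; apply: leq_addl.
have lt_Jq : ((J + x) * q.+1 <= q * D)%N.
  have h1 : (J <= J * x)%N by rewrite leq_pmulr.
  have h2 : (J.+1 * x <= q * x)%N.
    by rewrite leq_mul2r (leq_trans _ q_ge) ?orbT // ltnS leq_addr.
  have -> : ((J + x) * q.+1 = J * q + x * q + J + x)%N by rewrite mulnS mulnDl; lia.
  have -> : (q * D = J * q + x * q + q * x)%N by rewrite /D; lia.
  rewrite mulSn in h2; rewrite -addnA leq_add2l; lia.
have le_qD : (q * D <= n)%N by rewrite [leqRHS]En leq_addr.
have lt_J : (J * q.+1 < n)%N.
  apply: leq_trans le_qD; apply: leq_trans lt_Jq.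
  by rewrite ltn_mul2r /= -[ltnLHS]addn0 ltn_add2l.
have IHJ := IH _ lt_J; rewrite -/(V _) in IHJ.
apply: (@leq_trans (e * V (J * q.+1) + x * q.+1)%N).
  apply: (@leq_trans (e * (V (J * q.+1) + c * q.+1))%N); first by rewrite leq_mul2l step orbT.
  by rewrite mulnDr mulnA [(e * c)%N]mulnC.
apply: leq_trans (leq_add IHJ (leqnn _)) _.
by rewrite -addnA -mulnDl leq_add2l (leq_trans lt_Jq).
Qed.

(** * Contour sums on dyadic grids *)
Section Grid.
Variable R : realType.
Local Notation C := R[i].

Lemma nrmZ (V : normedModType C) (a : C) (v : V) : nrm (a *: v) = nrm a * nrm v.
Proof. by apply/complexI; rewrite rmorphM /= -!normE normrZ. Qed.

Definition mesh j : R := 2^-1 ^+ j.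
(** The square [[-3, 3] ^ 2], cut into cells of side [2 ^ (- j)]; it contains
    the unit disc with a margin, so that regions close to [K] avoid the frame. *)
Definition side j := (6 * 2 ^ j)%N.

Definition hmid j a b : C :=
  Complex ((a%:R + 2^-1) * mesh j - 3) (b%:R * mesh j - 3).
Definition vmid j a b : C :=
  Complex (a%:R * mesh j - 3) ((b%:R + 2^-1) * mesh j - 3).
Definition in_cell j a b (z : C) :=
  (a%:R * mesh j - 3 <= Re z <= a.+1%:R * mesh j - 3) &&
  (b%:R * mesh j - 3 <= Im z <= b.+1%:R * mesh j - 3).

Lemma mesh_gt0 j : 0 < mesh j. Proof. by rewrite exprn_gt0 // invr_gt0. Qed.
Lemma meshS j : mesh j = 2 * mesh j.+1.
Proof. by rewrite /mesh exprS mulrA divff ?mul1r // pnatr_eq0. Qed.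
Lemma mesh_side j : (side j)%:R * mesh j = 6.
Proof.
by rewrite /side /mesh natrM natrX exprVn -mulrA divff ?mulr1 // expf_neq0.
Qed.
Lemma sideS j : side j.+1 = (2 * side j)%N. Proof. by rewrite /side expnS; lia. Qed.

Lemma natrS (n : nat) : n.+1%:R = n%:R + 1 :> R. Proof. by rewrite -addn1 natrD. Qed.

Lemma hmid_in_cell j a b : in_cell j a b (hmid j a b).
Proof. by have := mesh_gt0 j; rewrite /in_cell /= ?(natrS a) ?(natrS b) => h; apply/andP; split; apply/andP; split; lra. Qed.
Lemma hmid_in_cell_below j a b : in_cell j a b (hmid j a b.+1).
Proof. by have := mesh_gt0 j; rewrite /in_cell /= ?(natrS a) ?(natrS b) => h; apply/andP; split; apply/andP; split; lra. Qed.
Lemma vmid_in_cell j a b : in_cell j a b (vmid j a b).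
Proof. by have := mesh_gt0 j; rewrite /in_cell /= ?(natrS a) ?(natrS b) => h; apply/andP; split; apply/andP; split; lra. Qed.
Lemma vmid_in_cell_left j a b : in_cell j a b (vmid j a.+1 b).
Proof. by have := mesh_gt0 j; rewrite /in_cell /= ?(natrS a) ?(natrS b) => h; apply/andP; split; apply/andP; split; lra. Qed.

Lemma in_cell_half j a b z : in_cell j.+1 a b z -> in_cell j a./2 b./2 z.
Proof.
have half1 (c : nat) (x : R) : c%:R * mesh j.+1 - 3 <= x <= c.+1%:R * mesh j.+1 - 3 ->
    (c./2)%:R * mesh j - 3 <= x <= (c./2).+1%:R * mesh j - 3.
  rewrite (meshS j) (natrS c) (natrS c./2).
  have -> : c%:R = (odd c)%:R + 2 * (c./2)%:R :> R by rewrite -natrM mul2n -natrD odd_double_half.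
  have := mesh_gt0 j.+1; set h := mesh _; case: (odd c) => /= h0 /andP[h1 h2]; apply/andP; split; lra.
by move=> /andP[h1 h2]; apply/andP; split; apply: half1.
Qed.

Section Sums.
Variable V : lmodType C.
Implicit Types (f : C -> V).

Lemma sum_doubling (E : nat -> V) n :
  \sum_(a < 2 * n) E a = \sum_(a < n) (E a.*2 + E a.*2.+1).
Proof.
elim: n => [|n IH]; first by rewrite !big_ord0.
rewrite mulnS !add2n !big_ord_recr /= IH addrA; congr (_ + _ + _); congr E; lia.
Qed.

Lemma abel_sum (w : nat -> C) (F : nat -> V) n : w 0%N = 0 -> w n = 0 ->
  \sum_(b < n) w b *: (F b - F b.+1) = \sum_(b < n) (w b.+1 - w b) *: F b.+1.
Proof.
move=> w0 wn; suff -> : \sum_(b < n) w b *: (F b - F b.+1) =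
    \sum_(b < n) (w b.+1 - w b) *: F b.+1 - w n *: F n.
  by rewrite wn scale0r subr0.
elim: n {wn} => [|n IH]; first by rewrite !big_ord0 w0 scale0r subr0.
rewrite !big_ord_recr /= IH scalerBr scalerBl -!addrA; congr (_ + _).
by rewrite addKr addrCA subrr addr0.
Qed.

(** The sum over the edges of the cell [(a, b)], counterclockwise, of a function
    [H] of the bottom edges and a function [W] of the left edges. *)
Definition circulation (H W : nat -> nat -> V) a b : V :=
  H a b + W a.+1 b - H a b.+1 - W a b.

Definition vanish_on_frame n (w : nat -> nat -> bool) :=
  forall c, [/\ w 0%N c = false, w c 0%N = false, w n c = false & w c n = false].

Definition bool_coef (b : bool) : C := b%:R.

(** Summation by parts: the edges between two cells of equal weight cancel.  In
    particular the sum depends only on the values on the boundary of the region. *)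
Lemma sum_circulation n (w : nat -> nat -> bool) H W : vanish_on_frame n w ->
  \sum_(a < n) \sum_(b < n) bool_coef (w a b) *: circulation H W a b =
  \sum_(a < n) \sum_(b < n) (bool_coef (w a b.+1) - bool_coef (w a b)) *: H a b.+1 -
  \sum_(a < n) \sum_(b < n) (bool_coef (w a.+1 b) - bool_coef (w a b)) *: W a.+1 b.
Proof.
move=> w_frame.
have -> : \sum_(a < n) \sum_(b < n) bool_coef (w a b) *: circulation H W a b =
   \sum_(a < n) \sum_(b < n) bool_coef (w a b) *: (H a b - H a b.+1) -
   \sum_(a < n) \sum_(b < n) bool_coef (w a b) *: (W a b - W a.+1 b).
  rewrite -sumrB; apply: eq_bigr => a _; rewrite -sumrB; apply: eq_bigr => b _.
  rewrite -scalerBr; congr (_ *: _); rewrite /circulation opprB.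
  by rewrite addrA; congr (_ - _); exact: addrAC.
congr (_ - _).
  apply: eq_bigr => a _; apply: (abel_sum (w := fun b => bool_coef (w a b))).
    by case: (w_frame a) => _ ->.
  by case: (w_frame a) => _ _ _ ->.
rewrite exchange_big [RHS]exchange_big /=; apply: eq_bigr => b _.
apply: (abel_sum (w := fun a => bool_coef (w a b)) (fun a => W a b)).
  by case: (w_frame b) => ->.
by case: (w_frame b) => _ _ ->.
Qed.

(** The midpoint rule for the integral of [f] around a cell. *)
Definition cell j f :=
  circulation (fun a b => (mesh j)%:C%C *: f (hmid j a b))
              (fun a b => ('i%C * (mesh j)%:C%C) *: f (vmid j a b)).

Definition contour j (w : nat -> nat -> bool) f : V :=
  \sum_(a < side j) \sum_(b < side j) bool_coef (w a b) *: cell j f a b.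

(** The same region on the grid of half mesh. *)
Definition refine (w : nat -> nat -> bool) a b := w a./2 b./2.

Lemma glue_vertical (h0 h1 h2 e0 e1 w0 w1 : V) :
  (h0 + e0 - h1 - w0) + (h1 + e1 - h2 - w1) = h0 + (e0 + e1) - h2 - (w0 + w1).
Proof. by rewrite opprD !addrA [LHS](ACl (1*2*6*7*4*8*3*5)) /= subrK. Qed.

Lemma glue_horizontal (h0 h1 k0 k1 w0 w1 w2 : V) :
  (h0 + w1 - k0 - w0) + (h1 + w2 - k1 - w1) = (h0 + h1) + w2 - (k0 + k1) - w0.
Proof. by rewrite opprD !addrA [LHS](ACl (1*5*6*3*7*4*2*8)) /= addrK. Qed.

Lemma circulationB (h0 e k w h0' e' k' w' : V) :
  (h0 + e - k - w) - (h0' + e' - k' - w') =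
  (h0 - h0') + (e - e') - (k - k') - (w - w').
Proof. by rewrite !(opprB, opprD, opprK) !addrA [LHS](ACl (1*7*2*8*6*3*5*4)). Qed.

Lemma half_doubleS n : n.*2.+1./2 = n. Proof. exact: (half_bit_double n true). Qed.

(** On each edge, what remains is the difference between the midpoint rules with
    two nodes and with one node. *)
Lemma contour_refine j w f : contour j.+1 (refine w) f - contour j w f =
  \sum_(a < side j) \sum_(b < side j) bool_coef (w a b) *: circulation
    (fun a b => (mesh j.+1)%:C%C *: (f (hmid j.+1 a.*2 b.*2) + f (hmid j.+1 a.*2.+1 b.*2))
                - (mesh j)%:C%C *: f (hmid j a b))
    (fun a b => ('i%C * (mesh j.+1)%:C%C) *: (f (vmid j.+1 a.*2 b.*2) + f (vmid j.+1 a.*2 b.*2.+1))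
                - ('i%C * (mesh j)%:C%C) *: f (vmid j a b)) a b.
Proof.
rewrite /contour sideS (sum_doubling (fun a => \sum_(b < _) bool_coef (refine w a b) *: cell j.+1 f a b)).
rewrite -sumrB; apply: eq_bigr => a _.
rewrite !(sum_doubling (fun b => bool_coef (refine w _ b) *: cell j.+1 f _ b)).
rewrite -big_split -sumrB; apply: eq_bigr => b _.
rewrite /refine !doubleK !half_doubleS /= -!scalerDr -scalerBr; congr (_ *: _).
rewrite /cell /circulation !doubleS !glue_vertical glue_horizontal circulationB.
by rewrite -!scalerDr.
Qed.
End Sums.
End Grid.

(** * Resolvents *)
Section Completeness.
Variable R : realType.
Local Notation C := R[i].

Lemma mesh_small (c e : R) : 0 < e -> exists N, forall n, (N <= n)%N -> c * mesh R n < e.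
Proof.
move=> e0; pose x := `|c| / e; exists (Num.bound x) => n le_n.
have x0 : 0 <= x by rewrite divr_ge0 // ltW.
have xn : x < (2 ^ n)%:R.
  apply: lt_le_trans (archi_boundP x0) _; rewrite ler_nat.
  by apply: leq_trans le_n _; rewrite ltnW // ltn_expl.
apply: le_lt_trans (_ : `|c| * mesh R n < e).
  by rewrite ler_wpM2r ?ler_norm // ltW // mesh_gt0.
move: xn; rewrite ltr_pdivrMr // natrX mulrC => h.
by rewrite /mesh exprVn ltr_pdivrMr // exprn_gt0.
Qed.

Lemma nrm_lt (V : normedZmodType C) (v : V) (e : C) : 0 < e -> (`|v| < e) = (nrm v < Re e).
Proof. by rewrite normE !ltcE /= => /andP[/eqP-> _]; rewrite eqxx. Qed.

Lemma ball_nrm (X : normedModType C) (x y : X) (e : C) : 0 < e ->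
  ball x e y = (nrm (x - y) < Re e) :> Prop.
Proof. by move=> e0; rewrite -ball_normE /ball_ /= nrm_lt. Qed.

Lemma complete_geometric (X : completeNormedModType C) (u : nat -> X) (c : R) :
    (forall n, nrm (u n.+1 - u n) <= c * mesh R n) ->
  exists l, forall n, nrm (u n - l) <= 2 * c * mesh R n.
Proof.
move=> du.
have u_le n k : nrm (u n - u (n + k)%N) <= 2 * c * mesh R n - 2 * c * mesh R (n + k).
  elim: k => [|k IH]; first by rewrite addn0 !subrr nrm0.
  rewrite addnS; have := nrm_triangle (u (n + k)%N) (u n) (u (n + k).+1).
  have := du (n + k)%N; rewrite [nrm (u _.+1 - _)]nrm_distC.
  by move: IH; rewrite (meshS R (n + k)); lra.
have c0 : 0 <= c.
  have := le_trans (nrm_ge0 _) (du 0%N); by rewrite /mesh expr0 mulr1.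
have u_le' n k : nrm (u n - u (n + k)%N) <= 2 * c * mesh R n.
  apply: le_trans (u_le n k) _; rewrite gerBl !mulr_ge0 //.
  by rewrite ltW // mesh_gt0.
have /cauchy_cvg u_cvg : cauchy (u @ \oo).
  apply/cauchyP => e e0.
  have Re0 : 0 < Re e by move: e0; rewrite ltcE => /andP[].
  have [N small] := mesh_small (2 * c) Re0.
  exists (u N); exists N => // n /= le_n; rewrite ball_nrm //.
  by rewrite -(subnKC le_n); apply: le_lt_trans (u_le' _ _) (small N _).
exists (lim (u @ \oo)) => n; apply/ler_addgt0Pr => e e0.
have eC0 : 0 < (e%:C)%C by rewrite ltcR.
have [N _ near_l] := u_cvg _ (nbhsx_ballx (lim (u @ \oo)) _ eC0).
have := near_l (n + N)%N (leq_addl _ _); rewrite /= ball_nrm // => lt_e.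
have := nrm_triangle (u (n + N)%N) (u n) (lim (u @ \oo)).
rewrite [nrm (u (n + N)%N - _)]nrm_distC; have := u_le' n N; rewrite /= in lt_e; lra.
Qed.
End Completeness.

Section Resolvent.
Variable R : realType.
Local Notation C := R[i].
Variable X : completeNormedModType C.

Lemma nrm_small0 (v : X) : (forall e, 0 < e -> nrm v <= e) -> v = 0.
Proof.
move=> small; apply: nrm_eq0; apply/eqP; rewrite eq_le nrm_ge0 andbT.
by apply/ler_addgt0Pr => e e0; rewrite add0r small.
Qed.

Definition op_bound (A : X -> X) M := forall x, nrm (A x) <= M * nrm x.

Lemma bounded_operatorP (S : {linear X -> X}) :
  bounded_operator S <-> exists2 M, 0 < M & op_bound S M.
Proof.
split=> [/linear_boundedP/pinfty_ex_gt0[M M0 SM]|[M M0 SM]].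
  exists (Re M); first by move: M0; rewrite ltcE => /andP[].
  move=> x; have := SM x; have -> : M = ((Re M)%:C)%C.
    by move: M0; rewrite ltcE => /andP[/eqP]; case: M {SM} => a b /= ->.
  by rewrite !normE -rmorphM /= lecR.
apply/linear_boundedP; exists (M%:C)%C; split; first by rewrite complex_real.
move=> r; rewrite ltcE => /andP[/eqP ir /= Mr] x.
have -> : r = ((Re r)%:C)%C by move: ir; case: r {Mr} => a b /= ->.
rewrite !normE -rmorphM /= lecR; apply: le_trans (SM x) _.
by rewrite ler_wpM2r ?nrm_ge0 // ltW.
Qed.

(** Neumann series: the solution of [x - A x = y] is the limit of the sequence
    [u n.+1 = y + A (u n)]. *)
Lemma contraction_inverse (A : {linear X -> X}) : op_bound A 2^-1 ->
  exists S : X -> X, [/\ cancel (fun x => x - A x) S, cancel S (fun x => x - A x) & op_bound S 2].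
Proof.
move=> A2.
have inj0 x : nrm x <= 2 * nrm (x - A x).
  have := nrmD (x - A x) (A x); rewrite subrK; have := A2 x; lra.
have solve y : exists x, x - A x = y.
  pose u := fix u n := if n is n'.+1 then y + A (u n') else 0.
  have du n : nrm (u n.+1 - u n) <= nrm y * mesh R n.
    elim: n => [|n IH]; first by rewrite /= linear0 addr0 subr0 /mesh expr0 mulr1.
    rewrite /= -[y + A (u n.+1)]/(y + A (u n.+1)) opprD addrACA subrr add0r -linearB.
    apply: le_trans (A2 _) _; move: IH; rewrite (meshS R n) /=.
    set m := mesh R n.+1; set v := nrm y; lra.
  have [l ul] := complete_geometric du; exists l.
  apply/eqP; rewrite -subr_eq0; apply/eqP; apply: nrm_small0 => e e0.
  have [N small] := mesh_small (4 * nrm y) e0.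
  have {}small := small N (leqnn N).
  have -> : l - A l - y = (l - u N.+1) - A (l - u N).
    by rewrite linearB /= !opprD !opprK !addrA [LHS](ACl (1*3*2)) /= [RHS](ACl (1*2*4*3)) /= subrK.
  have h1 := ul N.+1; have h2 := ul N; have h3 := A2 (l - u N).
  have h4 := nrmB (l - u N.+1) (A (l - u N)).
  rewrite nrm_distC in h1; rewrite nrm_distC in h2.
  have := mesh_gt0 R N.+1; have := meshS R N; have := nrm_ge0 y.
  move: h1 h2 h3 h4 small; set m := mesh R N; set m' := mesh R N.+1; set v := nrm y; nra.
have [S SE] := choice solve; exists S; split => //.
- move=> x; apply/eqP; rewrite -subr_eq0; apply/eqP; apply: nrm_eq0.
  have := inj0 (S (x - A x) - x); rewrite linearB /= opprB.
  have -> : S (x - A x) - x + (A x - A (S (x - A x))) =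
            (S (x - A x) - A (S (x - A x))) - (x - A x).
    by rewrite opprB !addrA [LHS](ACl (1*4*3*2)).
  rewrite SE subrr nrm0 mulr0 => h; apply/eqP; rewrite eq_le nrm_ge0 andbT.
  exact: h.
- by move=> y; have := inj0 (S y); rewrite SE.
Qed.

Variable T : {linear X -> X}.

Lemma resolvent_setP z (S : X -> X) M :
    cancel (fun x => T x - z *: x) S -> cancel S (fun x => T x - z *: x) ->
    op_bound S M -> resolvent_set T z.
Proof.
move=> TK SK SM.
have linS : linear S.
  move=> a x y; apply: (can_inj TK); rewrite !SK linearP /= scalerDr scalerA mulrC -scalerA.
  rewrite opprD addrACA -scalerBr.
  by congr (_ *: _ + _); rewrite SK.
pose L : {linear X -> X} := HB.pack S (GRing.isLinear.Build _ _ _ _ S linS).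
exists L => //; apply/bounded_operatorP; exists (`|M| + 1); first by rewrite ltr_wpDl.
move=> x; apply: le_trans (SM x) _; rewrite ler_wpM2r ?nrm_ge0 //.
by rewrite (le_trans (ler_norm M)) // lerDl.
Qed.

(** The inverse of [T - z] on the resolvent set.  On the spectrum it is set
    to zero: contour sums take this value only on edges that cancel. *)
Definition resolvent z : {linear X -> X} :=
  if pselect (resolvent_set T z) is left h then projT1 (cid2 h) else \0.

Lemma resolventP z : resolvent_set T z ->
  [/\ forall x, T (resolvent z x) = z *: resolvent z x + x,
      forall x, resolvent z (T x) = z *: resolvent z x + x & exists2 M, 0 < M & op_bound (resolvent z) M].
Proof.
rewrite /resolvent; case: pselect => // h _; case: cid2 => S /= /bounded_operatorP Sb [TK SK].
split => // x; apply/eqP; rewrite addrC -subr_eq; apply/eqP; first exact: SK.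
by have := TK x; rewrite linearB linearZ.
Qed.

Lemma resolvent_unique z x y : resolvent_set T z -> T x - z *: x = y -> x = resolvent z y.
Proof. by move=> /resolventP[_ h _] <-; rewrite linearB linearZ /= h addrC addKr. Qed.

Lemma resolventB a b y : resolvent_set T a -> resolvent_set T b ->
  resolvent a y - resolvent b y = (a - b) *: resolvent a (resolvent b y).
Proof.
move=> ha hb; have [_ ra _] := resolventP ha; have [rb _ _] := resolventP hb.
have := ra (resolvent b y); rewrite rb linearD linearZ /= => E.
by rewrite scalerBl -[resolvent a y](addKr (b *: resolvent a (resolvent b y))) E addrA addrK addrC.
Qed.

Lemma resolvent_open z M w : resolvent_set T z -> 0 < M -> op_bound (resolvent z) M ->
    nrm (w - z) * M <= 2^-1 ->
  resolvent_set T w /\ op_bound (resolvent w) (2 * M).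
Proof.
move=> hz M0 zM wz.
pose A : {linear X -> X} := (w - z) \*: resolvent z.
have A2 : op_bound A 2^-1.
  move=> x; rewrite /A /= nrmZ; apply: le_trans (ler_wpM2l (nrm_ge0 _) (zM x)) _.
  by rewrite mulrA ler_wpM2r ?nrm_ge0.
have [S [S1 S2 Sb]] := contraction_inverse A2.
have [r1 r2 _] := resolventP hz.
have SS : op_bound (fun y => S (resolvent z y)) (2 * M).
  by move=> y; apply: le_trans (Sb _) _; rewrite -mulrA ler_wpM2l.
have cK : cancel (fun y => S (resolvent z y)) (fun x => T x - w *: x).
  move=> y; set u := S _.
  have Eu : u = (w - z) *: resolvent z u + resolvent z y.
    by have := S2 (resolvent z y); rewrite -/u /A /= => <-; rewrite addrC subrK.
  have Tu : T u = w *: u + y.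
    rewrite [in LHS]Eu linearD linearZ /= !r1 scalerDr addrACA.
    rewrite scalerA mulrC -scalerA -scalerDr -Eu addrA -scalerDl.
    by rewrite [z + _]addrC subrK.
  by rewrite Tu addrC addKr.
have Kc : cancel (fun x => T x - w *: x) (fun y => S (resolvent z y)).
  move=> x; rewrite linearB linearZ /= r2.
  rewrite -[RHS]S1; congr S; rewrite /A /= scalerBl opprB addrA.
  by congr (_ - _); rewrite addrC.
have hw := resolvent_setP Kc cK SS; split => // y.
by rewrite -(resolvent_unique hw (cK y)).
Qed.
End Resolvent.

(** * The boundary of a region *)
Section Variation.
Variable R : realType.
Local Notation C := R[i].

(** The number of edges of the boundary of the region [w]. *)
Definition variation n (w : nat -> nat -> bool) : nat :=
  (\sum_(a < n) \sum_(b < n) (w a b.+1 != w a b) +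
   \sum_(a < n) \sum_(b < n) (w a.+1 b != w a b))%N.

Lemma sumn_doubling (E : nat -> nat) n :
  (\sum_(a < 2 * n) E a = \sum_(a < n) (E a.*2 + E a.*2.+1))%N.
Proof.
elim: n => [|n IH]; first by rewrite !big_ord0.
rewrite mulnS !add2n !big_ord_recr /= IH addnA; congr (_ + E _ + E _)%N; lia.
Qed.

Lemma variation_refine n w : variation (2 * n) (refine w) = (2 * variation n w)%N.
Proof.
rewrite /variation mulnDr; congr (_ + _)%N.
  rewrite (sumn_doubling (fun a => \sum_(b < _) (refine w a b.+1 != refine w a b))%N).
  rewrite big_distrr /=; apply: eq_bigr => a _.
  rewrite !(sumn_doubling (fun b => (refine w _ b.+1 != refine w _ b) : nat)).
  rewrite /refine -big_split big_distrr; apply: eq_bigr => b _.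
  by rewrite !doubleK !half_doubleS -!doubleS !doubleK !eqxx /= mul2n -addnn.
rewrite (sumn_doubling (fun a => \sum_(b < _) (refine w a.+1 b != refine w a b))%N).
rewrite big_distrr /=; apply: eq_bigr => a _.
rewrite !(sumn_doubling (fun b => (refine w _ b != refine w _ b) : nat)).
rewrite /refine -big_split big_distrr; apply: eq_bigr => b _.
by rewrite !doubleK !half_doubleS -!doubleS !doubleK !eqxx /= mul2n -addnn.
Qed.

Section Bound.
Variable V : normedModType C.

Lemma circulation_bound n (w : nat -> nat -> bool) (H W : nat -> nat -> V) (d : R) :
    0 <= d -> vanish_on_frame n w ->
    (forall a b, w a b.+1 != w a b -> nrm (H a b.+1) <= d) ->
    (forall a b, w a.+1 b != w a b -> nrm (W a.+1 b) <= d) ->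
  nrm (\sum_(a < n) \sum_(b < n) bool_coef R (w a b) *: circulation H W a b)
    <= d * (variation n w)%:R.
Proof.
move=> d0 wf Hd Wd; rewrite sum_circulation //.
have term (b b' : bool) (v : V) : (b != b' -> nrm v <= d) ->
    nrm ((bool_coef R b - bool_coef R b') *: v) <= d * (b != b')%:R.
  by case: b b' => -[] /= h; rewrite /bool_coef ?subrr ?scale0r ?nrm0 ?mulr0 // ?subr0 ?sub0r
     ?scaleN1r ?nrmN ?scale1r mulr1 h.
apply: le_trans (nrmB _ _) _; rewrite /variation natrD mulrDr; apply: lerD;
  apply: le_trans (nrm_sum _ _ _) _; rewrite natr_sum mulr_sumr; apply: ler_sum => a _;
  apply: le_trans (nrm_sum _ _ _) _; rewrite natr_sum mulr_sumr; apply: ler_sum => b _;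
  apply: term; [exact: Hd | exact: Wd].
Qed.
End Bound.

Variable G : C -> Prop.

Definition cuts_in j (w : nat -> nat -> bool) :=
  [/\ vanish_on_frame (side j) w,
      forall a b z, w a b.+1 != w a b -> in_cell j a b z -> in_cell j a b.+1 z -> G z
    & forall a b z, w a.+1 b != w a b -> in_cell j a b z -> in_cell j a.+1 b z -> G z].

Lemma nrm_mesh j : nrm ((mesh R j)%:C%C) = mesh R j.
Proof. by rewrite nrm_real ger0_norm // ltW // mesh_gt0. Qed.
Lemma nrm_i : nrm ('i%C : C) = 1.
Proof. by rewrite nrm_def /= expr0n add0r expr1n sqrtr1. Qed.

Lemma contour_bound (V : normedModType C) j w (f : C -> V) M : cuts_in j w -> 0 <= M ->
  (forall z, G z -> nrm (f z) <= M) ->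
  nrm (contour j w f) <= M * (mesh R j * (variation (side j) w)%:R).
Proof.
case=> wf wh wv M0 fM; rewrite mulrA.
have h0 := ltW (mesh_gt0 R j).
apply: circulation_bound => //; first by rewrite mulr_ge0.
  move=> a b ne; rewrite nrmZ nrm_mesh mulrC ler_wpM2r // fM //; apply: wh ne _ _.
    exact: hmid_in_cell_below.
  exact: hmid_in_cell.
move=> a b ne; rewrite nrmZ nrmM nrm_mesh nrm_i mul1r mulrC ler_wpM2r // fM //; apply: wv ne _ _.
  exact: vmid_in_cell_left.
exact: vmid_in_cell.
Qed.

Lemma eq_contour (V : normedModType C) j w (f g : C -> V) : cuts_in j w ->
  (forall z, G z -> f z = g z) -> contour j w f = contour j w g.
Proof.
move=> cw fg; apply/eqP; rewrite -subr_eq0.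
have -> : contour j w f - contour j w g = contour j w (fun z => f z - g z).
  rewrite /contour -sumrB; apply: eq_bigr => a _; rewrite -sumrB; apply: eq_bigr => b _.
  rewrite -scalerBr /cell /circulation circulationB; congr (_ *: _).
  by rewrite -!scalerBr.
apply/eqP; apply: nrm_eq0; apply/eqP; rewrite eq_le nrm_ge0 andbT.
have := contour_bound cw (lexx 0) (f := fun z => f z - g z); rewrite mul0r; apply => z Gz.
by rewrite fg // subrr nrm0.
Qed.

Lemma contourD (V : lmodType C) j w (f g : C -> V) :
  contour j w (fun z => f z + g z) = contour j w f + contour j w g.
Proof.
rewrite /contour -big_split; apply: eq_bigr => a _; rewrite -big_split; apply: eq_bigr => b _.
rewrite /= -scalerDr /cell /circulation; congr (_ *: _); rewrite !scalerDr !opprD.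
by rewrite !addrA [LHS](ACl (1*3*5*7*2*4*6*8)).
Qed.

Lemma contourZ (V : lmodType C) j w (f : C -> V) c :
  contour j w (fun z => c *: f z) = c *: contour j w f.
Proof.
rewrite /contour scaler_sumr; apply: eq_bigr => a _; rewrite scaler_sumr; apply: eq_bigr => b _.
rewrite !scalerA mulrC -scalerA /cell /circulation; congr (_ *: _).
by rewrite !scalerDr !scalerN !scalerA ![_ * c]mulrC.
Qed.

Lemma contour_linear (V W : lmodType C) (L : {linear V -> W}) j w (f : C -> V) :
  L (contour j w f) = contour j w (fun z => L (f z)).
Proof.
rewrite /contour linear_sum; apply: eq_bigr => a _; rewrite linear_sum; apply: eq_bigr => b _.
rewrite linearZ /=; congr (_ *: _).
by rewrite /cell /circulation !(raddfB L) (raddfD L) /= !linearZ.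
Qed.
End Variation.

(** * Discrete forms of Cauchy's theorem *)
Section CellMidpoints.
Variables (R : realType) (j a b : nat).
Let m1 := hmid R j a b.
Let m2 := vmid R j a.+1 b.
Let m3 := hmid R j a b.+1.
Let m4 := vmid R j a b.

Lemma cell_midpoints_sum : m1 + m3 = m2 + m4.
Proof.
by apply/eqP; rewrite eq_complex /= (natrS R a) (natrS R b); apply/andP; split; apply/eqP; lra.
Qed.

Lemma cell_midpoints_vert : m1 - m3 = - ('i%C * (mesh R j)%:C%C).
Proof.
by apply/eqP; rewrite eq_complex /= (natrS R b); apply/andP; split; apply/eqP; lra.
Qed.

Lemma cell_midpoints_hor : m2 - m4 = (mesh R j)%:C%C.
Proof.
by apply/eqP; rewrite eq_complex /= (natrS R a); apply/andP; split; apply/eqP; lra.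
Qed.

Lemma cell_midpoints_prod : m1 * m3 - m2 * m4 = (mesh R j ^+ 2 / 2)%:C%C.
Proof.
by apply/eqP; rewrite eq_complex /= (natrS R a) (natrS R b); apply/andP; split; apply/eqP; field.
Qed.
End CellMidpoints.

Section Estimates.
Variable R : realType.
Local Notation C := R[i].
Variable X : completeNormedModType C.
Variable T : {linear X -> X}.
Variables (G : C -> Prop) (M : R).
Hypothesis M0 : 0 < M.
Hypothesis goodG : forall z, G z -> resolvent_set T z /\ op_bound (resolvent T z) M.

Lemma resolvent_le z y : G z -> nrm (resolvent T z y) <= M * nrm y.
Proof. by move=> /goodG[_]; apply. Qed.

Lemma resolvent_setG z : G z -> resolvent_set T z. Proof. by move=> /goodG[]. Qed.

Lemma powM_ge0 k (y : X) : 0 <= M ^+ k * nrm y.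
Proof. exact: mulr_ge0 (exprn_ge0 _ (ltW M0)) (nrm_ge0 _). Qed.

(** By the resolvent identity this is [(p1 - m) * (p1 - p2)] times a product of
    three resolvents. *)
Lemma resolvent_second_difference p1 p2 m y : G p1 -> G p2 -> G m -> p1 + p2 = m + m ->
  nrm (resolvent T p1 y + resolvent T p2 y - 2 *: resolvent T m y)
    <= nrm (p1 - m) * nrm (p1 - p2) * (M ^+ 3 * nrm y).
Proof.
move=> g1 g2 gm E; have [r1 r2 rm] := And3 (resolvent_setG g1) (resolvent_setG g2) (resolvent_setG gm).
have -> : resolvent T p1 y + resolvent T p2 y - 2 *: resolvent T m y =
   ((p1 - m) * (p1 - p2)) *: resolvent T p1 (resolvent T p2 (resolvent T m y)).
  rewrite scaler_nat mulr2n opprD addrACA (resolventB y r1 rm) (resolventB y r2 rm).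
  have -> : p2 - m = - (p1 - m) by apply/eqP; rewrite -subr_eq0 -[p2](addKr p1) E; apply/eqP; ring.
  by rewrite scaleNr -scalerBr (resolventB _ r1 r2) scalerA.
rewrite nrmZ nrmM -!mulrA ler_wpM2l ?nrm_ge0 // ler_wpM2l ?nrm_ge0 //.
have h1 := resolvent_le (resolvent T p2 (resolvent T m y)) g1.
have h2 := resolvent_le (resolvent T m y) g2; have h3 := resolvent_le y gm.
apply: le_trans h1 _; rewrite ler_wpM2l ?(ltW M0) //.
by apply: le_trans h2 _; rewrite ler_wpM2l ?(ltW M0).
Qed.

Lemma nrm_le_mesh j (x y : R) : `|x| + `|y| <= mesh R j -> nrm (Complex x y : C) <= mesh R j.
Proof. by move=> h; apply: le_trans (nrm_ReIm _) _. Qed.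

(** Each boundary edge contributes a second difference of the resolvent, that
    is [O(mesh ^ 3)], and there are [O(1 / mesh)] such edges. *)
Lemma contour_halving j w y : cuts_in G j w ->
  nrm (contour j.+1 (refine w) (fun z => resolvent T z y) - contour j w (fun z => resolvent T z y))
    <= mesh R j ^+ 3 * (M ^+ 3 * nrm y) * (variation (side j) w)%:R.
Proof.
case=> wf wh wv; rewrite contour_refine; have h0 := mesh_gt0 R j; have h0' := mesh_gt0 R j.+1.
have hE := meshS R j.
have d0 : 0 <= mesh R j ^+ 3 * (M ^+ 3 * nrm y).
  exact: mulr_ge0 (exprn_ge0 _ (ltW h0)) (powM_ge0 3 y).
have edge (p1 p2 m : C) : G p1 -> G p2 -> G m -> p1 + p2 = m + m ->
    nrm (p1 - m) <= mesh R j -> nrm (p1 - p2) <= mesh R j ->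
    nrm ((mesh R j.+1)%:C%C *: (resolvent T p1 y + resolvent T p2 y) - (mesh R j)%:C%C *: resolvent T m y)
     <= mesh R j ^+ 3 * (M ^+ 3 * nrm y).
  move=> g1 g2 gm E l1 l2.
  have -> : (mesh R j)%:C%C = (mesh R j.+1)%:C%C * 2 :> C.
    by rewrite hE rmorphM /= rmorph_nat mulrC.
  rewrite -scalerA -scalerBr nrmZ nrm_mesh exprS -mulrA.
  apply: ler_pM; rewrite ?nrm_ge0 ?(ltW h0') //; first by rewrite hE; lra.
  apply: le_trans (resolvent_second_difference y g1 g2 gm E) _; rewrite ler_wpM2r ?powM_ge0 //.
  by rewrite expr2 ler_pM ?nrm_ge0.
have dbl (c : nat) : c.*2%:R = 2 * c%:R :> R by rewrite -mul2n natrM.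
have abs2 (u v e : R) : u + v <= e -> u - v <= e -> - u + v <= e -> - u - v <= e ->
    `|u| + `|v| <= e.
  by move=> *; case: (ger0P u); case: (ger0P v) => *; lra.
have inS a b z : in_cell j.+1 a.*2 b.*2 z -> in_cell j a b z.
  by move=> /in_cell_half; rewrite !doubleK.
apply: circulation_bound => //.
  move=> a b ne; apply: edge.
  - apply: wh ne _ _; have := hmid_in_cell_below R j.+1 a.*2 b.*2.+1 => /in_cell_half;
      rewrite ?doubleK ?half_doubleS //.
    by move=> _; have := hmid_in_cell R j.+1 a.*2 b.+1.*2 => /inS.
  - apply: wh ne _ _; have := hmid_in_cell_below R j.+1 a.*2.+1 b.*2.+1 => /in_cell_half;
      rewrite ?doubleK ?half_doubleS //.
    by move=> _; have := hmid_in_cell R j.+1 a.*2.+1 b.+1.*2 => /in_cell_half; rewrite doubleK half_doubleS.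
  - apply: wh ne _ _; [exact: hmid_in_cell_below | exact: hmid_in_cell].
  - apply/eqP; rewrite eq_complex /= hE ?(natrS R a) ?(natrS R b) ?(natrS R a.*2) ?(natrS R b.*2) ?dbl ?(natrS R a) ?(natrS R b).
    by apply/andP; split; apply/eqP; lra.
  - apply: nrm_le_mesh; rewrite hE ?(natrS R a) ?(natrS R b) ?(natrS R a.*2) ?(natrS R b.*2) ?dbl ?(natrS R a) ?(natrS R b).
    by apply: abs2; lra.
  - apply: nrm_le_mesh; rewrite hE ?(natrS R a) ?(natrS R b) ?(natrS R a.*2) ?(natrS R b.*2) ?dbl ?(natrS R a) ?(natrS R b).
    by apply: abs2; lra.
move=> a b ne; rewrite -!scalerA -scalerBr nrmZ nrm_i mul1r; apply: edge.
  - apply: wv ne _ _; have := vmid_in_cell_left R j.+1 a.*2.+1 b.*2 => /in_cell_half;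
      rewrite ?doubleK ?half_doubleS //.
    by move=> _; have := vmid_in_cell R j.+1 a.+1.*2 b.*2 => /inS.
  - apply: wv ne _ _; have := vmid_in_cell_left R j.+1 a.*2.+1 b.*2.+1 => /in_cell_half;
      rewrite ?doubleK ?half_doubleS //.
    by move=> _; have := vmid_in_cell R j.+1 a.+1.*2 b.*2.+1 => /in_cell_half; rewrite doubleK half_doubleS.
  - apply: wv ne _ _; [exact: vmid_in_cell_left | exact: vmid_in_cell].
  - apply/eqP; rewrite eq_complex /= hE ?(natrS R a) ?(natrS R b) ?(natrS R a.*2) ?(natrS R b.*2) ?dbl ?(natrS R a) ?(natrS R b).
    by apply/andP; split; apply/eqP; lra.
  - apply: nrm_le_mesh; rewrite hE ?(natrS R a) ?(natrS R b) ?(natrS R a.*2) ?(natrS R b.*2) ?dbl ?(natrS R a) ?(natrS R b).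
    by apply: abs2; lra.
  - apply: nrm_le_mesh; rewrite hE ?(natrS R a) ?(natrS R b) ?(natrS R a.*2) ?(natrS R b.*2) ?dbl ?(natrS R a) ?(natrS R b).
    by apply: abs2; lra.
Qed.

Lemma quadratic_factor a b v : let u := T v - a *: v in
  T u - b *: u = T (T v) - (a + b) *: T v + (a * b) *: v.
Proof.
rewrite /= linearB linearZ /= scalerBr opprB scalerA [b * a]mulrC scalerDl opprD.
by rewrite !addrA [LHS](ACl (1*2*4*3)).
Qed.

Lemma resolvent_pair a b v : resolvent_set T a -> resolvent_set T b ->
  resolvent T a (resolvent T b (T (T v) - (a + b) *: T v + (a * b) *: v)) = v.
Proof.
move=> ha hb; rewrite -quadratic_factor; set u := T v - a *: v.
by rewrite -(resolvent_unique hb (erefl (T u - b *: u))) -(resolvent_unique ha (erefl u)).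
Qed.

Lemma resolvent_pairK a b y v : resolvent_set T a -> resolvent_set T b ->
  v = resolvent T a (resolvent T b y) -> y = T (T v) - (a + b) *: T v + (a * b) *: v.
Proof.
move=> ha hb ->; have [ra _ _] := resolventP ha; have [rb _ _] := resolventP hb.
rewrite -quadratic_factor /= ra [_ + resolvent T b y]addrC addrK rb.
by rewrite addrC addKr.
Qed.

(** The sum over the four edges equals [i h ^ 4 / 2] times the product of the
    resolvents at the four midpoints, [h] being the mesh. *)
Lemma cell_resolvent j a b y : (forall z, in_cell j a b z -> G z) ->
  nrm (cell j (fun z => resolvent T z y) a b) <= mesh R j ^+ 4 * (M ^+ 4 * nrm y).
Proof.
move=> cG; set h := (mesh R j)%:C%C.
pose m1 := hmid R j a b; pose m2 := vmid R j a.+1 b.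
pose m3 := hmid R j a b.+1; pose m4 := vmid R j a b.
have [g1 g2 g3 g4] : [/\ G m1, G m2, G m3 & G m4].
  by split; apply: cG; [exact: hmid_in_cell | exact: vmid_in_cell_left
    | exact: hmid_in_cell_below | exact: vmid_in_cell].
have [r1 r2 r3 r4] := And4 (resolvent_setG g1) (resolvent_setG g2) (resolvent_setG g3) (resolvent_setG g4).
pose v := resolvent T m2 (resolvent T m4 y).
have vE : v - resolvent T m1 (resolvent T m3 y) = (m1 * m3 - m2 * m4) *: resolvent T m1 (resolvent T m3 v).
  have Ey := resolvent_pairK r2 r4 (erefl v).
  have -> : y = (T (T v) - (m1 + m3) *: T v + (m1 * m3) *: v) - (m1 * m3 - m2 * m4) *: v.
    rewrite [LHS]Ey -(cell_midpoints_sum R j a b) scalerBl opprB addrA.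
    by rewrite addrAC addrK.
  set w := T (T v) - _ + _.
  by rewrite !linearB !linearZ /= /w resolvent_pair //= opprK addNKr.
have -> : cell j (fun z => resolvent T z y) a b =
   ('i%C * h * h * (m1 * m3 - m2 * m4)) *: resolvent T m1 (resolvent T m3 v).
  rewrite -scalerA -vE /cell /circulation -/h -/m1 -/m2 -/m3 -/m4.
  rewrite [LHS](ACl (1*3*(2*4))) /= -!scalerBr (resolventB y r1 r3) (resolventB y r2 r4) !scalerA.
  have -> : m1 - m3 = - ('i%C * h) by rewrite cell_midpoints_vert.
  have -> : m2 - m4 = h by rewrite cell_midpoints_hor.
  by rewrite scalerBr mulrN scaleNr addrC; congr (_ - _ *: _); exact: mulrC.
rewrite nrmZ !nrmM nrm_i mul1r nrm_mesh cell_midpoints_prod nrm_real.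
set k := mesh R j; have k0 : 0 < k := mesh_gt0 R j.
apply: (@le_trans _ _ (k ^+ 4 * nrm (resolvent T m1 (resolvent T m3 v)))).
  rewrite ler_wpM2r ?nrm_ge0 // !exprS expr0 mulr1 -mulrA ler_wpM2l // ?(ltW k0) //.
  by rewrite ler_wpM2l ?(ltW k0) // gtr0_norm ?divr_gt0 ?mulr_gt0 //; nra.
rewrite ler_wpM2l ?exprn_ge0 ?(ltW k0) //.
have h1 := resolvent_le (resolvent T m3 v) g1; have h3 := resolvent_le v g3.
have h2 := resolvent_le (resolvent T m4 y) g2; have h4 := resolvent_le y g4.
rewrite !exprS expr0 mulr1 -!mulrA.
do 3! (apply: le_trans; first by [exact: h1 | exact: h3 | exact: h2]; rewrite ler_wpM2l ?(ltW M0) //).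
Qed.
End Estimates.

Section RootProducts.
Variable R : realType.
Local Notation C := R[i].

Definition root_prod (rs : seq C) (z : C) : C := \prod_(r <- rs) (z - r).

Lemma root_prod_cons r rs z : root_prod (r :: rs) z = (z - r) * root_prod rs z.
Proof. by rewrite /root_prod big_cons. Qed.

(** A second-order Taylor estimate; the radius leaves room for the grid. *)
Definition smooth_on_ball (g : C -> C) := exists g' : C -> C, exists2 B : R, 0 <= B
  & forall c u, nrm c <= 10 -> nrm u <= 10 ->
    [/\ nrm (g (c + u) - g c - u * g' c) <= B * nrm u ^+ 2, nrm (g c) <= B & nrm (g' c) <= B].

Lemma smooth_root_prod rs : smooth_on_ball (root_prod rs).
Proof.
elim: rs => [|r rs [g' [B B0 IH]]].
  exists (fun=> 0), 1 => // c u _ _; rewrite /root_prod !big_nil.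
  by rewrite subrr mulr0 subr0 nrm0 nrm1 mul1r sqr_ge0.
set g := root_prod rs in IH *.
exists (fun c => (c - r) * g' c + g c), ((21 + nrm r) * B).
  by rewrite mulr_ge0 // addr_ge0 // nrm_ge0.
move=> c u cb ub; have [h1 h2 h3] := IH c u cb ub; have r0 := nrm_ge0 r.
have cr : nrm (c - r) <= 10 + nrm r by apply: le_trans (nrmB _ _) _; rewrite lerD2r.
rewrite !root_prod_cons -/g; split.
- have -> : (c + u - r) * g (c + u) - (c - r) * g c - u * ((c - r) * g' c + g c) =
      (c + u - r) * (g (c + u) - g c - u * g' c) + u ^+ 2 * g' c by ring.
  have cur : nrm (c + u - r) <= 20 + nrm r.
    by apply: le_trans (nrmB _ _) _; rewrite lerD2r; have := nrmD c u; lra.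
  apply: le_trans (nrmD _ _) _; rewrite nrmM [nrm (u ^+ 2 * _)]nrmM nrmX.
  have -> : (21 + nrm r) * B * nrm u ^+ 2 = (20 + nrm r) * (B * nrm u ^+ 2) + nrm u ^+ 2 * B by ring.
  by apply: lerD; [apply: ler_pM; rewrite ?nrm_ge0 | rewrite ler_wpM2l // exprn_ge0 // nrm_ge0].
- rewrite nrmM; apply: ler_pM; rewrite ?nrm_ge0 //; lra.
- apply: le_trans (nrmD _ _) _; rewrite nrmM.
  have : nrm (c - r) * nrm (g' c) <= (10 + nrm r) * B by apply: ler_pM; rewrite ?nrm_ge0.
  have : 0 <= nrm r * B by rewrite mulr_ge0.
  by move: h2; rewrite !mulrDl; lra.
Qed.

Definition center j a b : C :=
  Complex ((a%:R + 2^-1) * mesh R j - 3) ((b%:R + 2^-1) * mesh R j - 3).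

Lemma mesh_le1 j : mesh R j <= 1.
Proof. by rewrite /mesh exprn_ile1 // invf_le1 // ler1n. Qed.

Lemma index_range j a : (a < side j)%N -> 0 <= a%:R * mesh R j <= 6 - mesh R j.
Proof.
move=> lt_a; have h0 := mesh_gt0 R j; rewrite mulr_ge0 ?ler0n ?(ltW h0) //=.
rewrite -(mesh_side R j) -[X in _ - X]mul1r -mulrBl ler_wpM2r ?(ltW h0) //.
by rewrite lerBrDr -(natrS R a) ler_nat.
Qed.

Lemma cell_error_sum (B h e1 e2 e3 e4 : R) : 0 <= h ->
    e1 <= B * (h / 2) ^+ 2 -> e2 <= B * (h / 2) ^+ 2 ->
    e3 <= B * (h / 2) ^+ 2 -> e4 <= B * (h / 2) ^+ 2 ->
  2 * (h / 2) * e1 + 2 * (h / 2) * e2 + 2 * (h / 2) * e3 + 2 * (h / 2) * e4 <= B * h ^+ 3.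
Proof.
move=> h0 l1 l2 l3 l4; have -> : 2 * (h / 2) = h by field.
have -> : B * h ^+ 3 = h * (B * (h / 2) ^+ 2) + h * (B * (h / 2) ^+ 2) +
   h * (B * (h / 2) ^+ 2) + h * (B * (h / 2) ^+ 2) by field.
by rewrite !lerD // ler_wpM2l.
Qed.

(** The affine part of [g] has no circulation, and the remainder is
    [O(mesh ^ 2)] at each of the four midpoints. *)
Lemma cell_smooth (g : C -> C) : smooth_on_ball g ->
  exists B, forall j a b, (a < side j)%N -> (b < side j)%N ->
    nrm (cell j (g : C -> C^o) a b) <= B * mesh R j ^+ 3.
Proof.
move=> [g' [B B0 gB]]; exists B => j a b /index_range a_in /index_range b_in.
have h0 := mesh_gt0 R j; have h1 := mesh_le1 j; set h := mesh R j in h0 h1 a_in b_in *.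
pose c := center j a b.
have cb : nrm c <= 10.
  apply: le_trans (nrm_ReIm _) _; rewrite /c /=.
  have abs5 (x : R) : -5 <= x -> x <= 5 -> `|x| <= 5 by rewrite ler_norml => -> ->.
  apply: le_trans (lerD (abs5 _ _ _) (abs5 _ _ _)) _; rewrite -/h ?mulrDl; move: a_in b_in => /andP[? ?] /andP[? ?]; lra.
pose e x := g (c + x) - g c - x * g' c.
have eB x : nrm x = h / 2 -> nrm (e x) <= B * (h / 2) ^+ 2.
  move=> nx; have nx10 : nrm x <= 10 by rewrite nx; lra.
  by have [+ _ _] := gB c x cb nx10; rewrite nx.
have gE x : g (c + x) = g c + x * g' c + e x by rewrite /e; ring.
pose u := (h / 2)%:C%C.
have nu : nrm u = h / 2 by rewrite nrm_real gtr0_norm // divr_gt0.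
have niu : nrm ('i%C * u) = h / 2 by rewrite nrmM nrm_i mul1r.
have m1 : hmid R j a b = c + - ('i%C * u).
  by apply/eqP; rewrite eq_complex /= -/h; apply/andP; split; apply/eqP; lra.
have m2 : vmid R j a.+1 b = c + u.
  by apply/eqP; rewrite eq_complex /= -/h (natrS R a); apply/andP; split; apply/eqP; lra.
have m3 : hmid R j a b.+1 = c + 'i%C * u.
  by apply/eqP; rewrite eq_complex /= -/h (natrS R b); apply/andP; split; apply/eqP; lra.
have m4 : vmid R j a b = c + - u.
  by apply/eqP; rewrite eq_complex /= -/h; apply/andP; split; apply/eqP; lra.
rewrite /cell /circulation -/h m1 m2 m3 m4 !gE.
have -> : (h%:C%C : C) = 2 * u.
  by rewrite /u rmorphM /= fmorphV rmorph_nat mulrCA divff ?mulr1 // pnatr_eq0.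
set X := (X in nrm X).
have -> : X = 2 * u * e (- ('i%C * u)) + 'i%C * (2 * u) * e u - 2 * u * e ('i%C * u) - 'i%C * (2 * u) * e (- u).
  by rewrite /X /GRing.scale /=; ring.
apply: le_trans (nrmB _ _) _; apply: le_trans (lerD (nrmB _ _) (lexx _)) _.
apply: le_trans (lerD (lerD (nrmD _ _) (lexx _)) (lexx _)) _.
rewrite !nrmM nrm_i mul1r nu -[2 : C]/(2%:R) -(rmorph_nat (@real_complex_def R (Phant R)) 2) nrm_real ger0_norm //.
have l1 := eB _ nu; have l2 := eB _ niu.
have l3 : nrm (e (- u)) <= B * (h / 2) ^+ 2 by apply: eB; rewrite nrmN.
have l4 : nrm (e (- ('i%C * u))) <= B * (h / 2) ^+ 2 by apply: eB; rewrite nrmN.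
exact: cell_error_sum (ltW h0) l4 l1 l2 l3.
Qed.

Lemma contour_smooth_le (g : C -> C) : smooth_on_ball g ->
  exists B, forall j w, nrm (contour j w (g : C -> C^o)) <= B * mesh R j.
Proof.
move=> /cell_smooth[B gB]; exists (36 * B) => j w; have h0 := mesh_gt0 R j.
apply: le_trans (nrm_sum _ _ _) _.
have -> : 36 * B * mesh R j = \sum_(a < side j) \sum_(b < side j) (B * mesh R j ^+ 3).
  rewrite !sumr_const !card_ord -mulrnA -[RHS]mulr_natr natrM.
  have := mesh_side R j; set s := (side j)%:R; set h := mesh R j => sh.
  have -> : B * h ^+ 3 * (s * s) = B * (s * h) ^+ 2 * h by ring.
  by rewrite sh; ring.
apply: ler_sum => a _; apply: le_trans (nrm_sum _ _ _) _; apply: ler_sum => b _.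
have cellB := gB j a b (ltn_ord a) (ltn_ord b).
case: (w a b); rewrite /bool_coef ?scale1r ?scale0r //.
by rewrite nrm0; apply: le_trans (nrm_ge0 _) cellB.
Qed.
End RootProducts.

Section Pole.
Variable R : realType.
Local Notation C := R[i].

Lemma Im_inv (x y : R) : Im (Complex x y)^-1 = - y / (x ^+ 2 + y ^+ 2).
Proof. by rewrite mulNr. Qed.

Lemma Im_iinv (x y : R) : Im ('i%C * (Complex x y)^-1) = x / (x ^+ 2 + y ^+ 2).
Proof. by rewrite mulrC ImiRe. Qed.

Lemma side_ratio_bound (x y : R) : `|x| <= 4 -> 2 <= y <= 4 -> 16^-1 <= y / (x ^+ 2 + y ^+ 2).
Proof.
rewrite ler_norml => /andP[x1 x2] /andP[y1 y2].
have x2b : 0 <= (4 - x) * (4 + x) by rewrite mulr_ge0; lra.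
have y2b : 0 <= y * (4 - y) by rewrite mulr_ge0; lra.
have d0 : 0 < x ^+ 2 + y ^+ 2 by rewrite ltr_wpDl ?sqr_ge0 // exprn_gt0; lra.
rewrite ler_pdivlMr //; move: x2b y2b; rewrite !expr2; lra.
Qed.

Lemma Im_inv_ge (w : C) : `|Re w| <= 4 -> 2 <= - Im w <= 4 -> 16^-1 <= Im w^-1.
Proof. by case: w => x y hx h; rewrite Im_inv -(sqrrN y); exact: side_ratio_bound hx h. Qed.

Lemma Im_iinv_ge (w : C) : `|Im w| <= 4 -> 2 <= Re w <= 4 -> 16^-1 <= Im ('i%C * w^-1).
Proof. by case: w => x y hx h; rewrite Im_iinv addrC; exact: side_ratio_bound hx h. Qed.

Lemma telescope_sum (V : zmodType) (E : nat -> V) n : \sum_(b < n) (E b - E b.+1) = E 0%N - E n.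
Proof.
elim: n => [|n IH]; first by rewrite big_ord0 subrr.
by rewrite big_ord_recr /= IH addrA subrK.
Qed.

Lemma total_circulation (V : lmodType C) (H W : nat -> nat -> V) n :
  \sum_(a < n) \sum_(b < n) circulation H W a b =
  \sum_(a < n) (H a 0%N - H a n) + \sum_(b < n) (W n b - W 0%N b).
Proof.
have -> : \sum_(a < n) \sum_(b < n) circulation H W a b =
   \sum_(a < n) \sum_(b < n) (H a b - H a b.+1) - \sum_(b < n) \sum_(a < n) (W a b - W a.+1 b).
  rewrite [X in _ - X]exchange_big -sumrB; apply: eq_bigr => a _.
  rewrite -sumrB; apply: eq_bigr => b _; rewrite /circulation opprB.
  by rewrite addrA; congr (_ - _); exact: addrAC.
congr (_ + _); first by apply: eq_bigr => a _; rewrite (telescope_sum (H a)).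
rewrite -sumrN; apply: eq_bigr => b _.
by rewrite (telescope_sum (W^~ b)) opprB.
Qed.

(** The integral of [1 / (x - z)] around the whole square is [2 pi i].  Each edge
    contributes a positive imaginary part, at least [mesh / 16], whence this lower
    bound. *)
Lemma total_pole j (z : C) : `|Re z| <= 1 -> `|Im z| <= 1 ->
  1 <= Im (\sum_(a < side j) \sum_(b < side j) cell j (fun x => (x - z)^-1 : C^o) a b).
Proof.
rewrite !ler_norml => /andP[z1 z2] /andP[z3 z4].
have h0 := mesh_gt0 R j; have sh := mesh_side R j; set h := mesh R j in h0 sh.
have ImM (x : R) (y : C) : Im (x%:C%C * y) = x * Im y by case: y => a b /=; rewrite mul0r addr0.
have ImN (x : C) : Im (- x) = - Im x by case: x.
have ReN (x : C) : Re (- x) = - Re x by case: x.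
have terms (E : nat -> C) : (forall c, (c < side j)%N -> h / 8 <= Im (E c)) ->
    3 / 4 <= Im (\sum_(c < side j) E c).
  move=> EI; rewrite Im_sum; apply: le_trans (_ : \sum_(c < side j) (h / 8) <= _).
    by rewrite sumr_const card_ord -[_ *+ side j]mulr_natl mulrA sh; lra.
  by apply: ler_sum => c _; apply: EI.
have coordc c : (c < side j)%N -> -3 <= c%:R * h - 3 /\ (c%:R + 1) * h - 3 <= 3.
  move=> /(@index_range R) /andP[]; rewrite -/h => h1 h2; split; first lra.
  by rewrite mulrDl; lra.
rewrite /cell total_circulation ImD -/h.
pose E1 c : C := h%:C%C * (hmid R j c 0 - z)^-1 - h%:C%C * (hmid R j c (side j) - z)^-1.
pose E2 c : C := 'i%C * h%:C%C * (vmid R j (side j) c - z)^-1 - 'i%C * h%:C%C * (vmid R j 0 c - z)^-1.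
have S1 : 3 / 4 <= Im (\sum_(c < side j) E1 c).
  apply: terms => c /coordc[c1 c2]; rewrite ImD ImN !ImM -mulrBr.
  have -> : h / 8 = h * (16^-1 + 16^-1) by field.
  rewrite ler_wpM2l ?(ltW h0) //; apply: lerD; last rewrite -ImN -invrN; apply: Im_inv_ge;
    rewrite ?ler_norml !(ReD, ReN, ImD, ImN) /= ?sh -/h; lra.
have S2 : 3 / 4 <= Im (\sum_(c < side j) E2 c).
  apply: terms => c /coordc[c1 c2].
  rewrite /E2 ![_ * h%:C%C]mulrC -!mulrA ImD ImN !ImM -mulrBr.
  have -> : h / 8 = h * (16^-1 + 16^-1) by field.
  rewrite ler_wpM2l ?(ltW h0) //; apply: lerD; last rewrite -ImN -mulrN -invrN; apply: Im_iinv_ge;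
    rewrite ?ler_norml !(ReD, ReN, ImD, ImN) /= ?sh -/h; lra.
rewrite /GRing.scale /=; move: S1 S2; rewrite /E1 /E2; lra.
Qed.
End Pole.

(** * The Riesz operator *)
Section Tends.
Variable R : realType.
Variable V : normedZmodType R[i].
Implicit Types (u v : nat -> V) (l m : V).

Definition tends u l := forall e, 0 < e -> exists N, forall n, (N <= n)%N -> nrm (u n - l) <= e.

Lemma tends_le u l c : tends u l -> (forall n, nrm (u n) <= c) -> nrm l <= c.
Proof.
move=> ul uc; apply/ler_addgt0Pr => e e0; have [N uN] := ul e e0.
have := nrm_triangle (u N) l 0; rewrite !subr0 nrm_distC.
by have := uN N (leqnn N); have := uc N; lra.
Qed.

Lemma tendsD u v l m : tends u l -> tends v m -> tends (fun n => u n + v n) (l + m).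
Proof.
move=> ul vm e e0; have e20 : 0 < e / 2 by rewrite divr_gt0.
have [N uN] := ul _ e20; have [N' vN] := vm _ e20; exists (maxn N N') => n.
rewrite geq_max => /andP[/uN h1 /vN h2]; rewrite opprD addrACA.
by apply: le_trans (nrmD _ _) _; lra.
Qed.

Lemma tendsN u l : tends u l -> tends (fun n => - u n) (- l).
Proof. by move=> ul e /ul[N uN]; exists N => n /uN; rewrite -opprD nrmN. Qed.

Lemma tends_geometric u l c : (forall n, nrm (u n - l) <= c * mesh R n) -> tends u l.
Proof.
by move=> uc e e0; have [N sm] := mesh_small c e0; exists N => n /sm/ltW; apply: le_trans.
Qed.

Lemma tends_unique u l m : tends u l -> tends u m -> l = m.
Proof.
move=> ul um; apply/eqP; rewrite -subr_eq0; apply/eqP; apply: nrm_eq0.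
apply/eqP; rewrite eq_le nrm_ge0 andbT.
have h := tendsD ul (tendsN um).
by apply: (tends_le h) => n; rewrite subrr nrm0.
Qed.

Lemma eq_tends u v l : u =1 v -> tends u l -> tends v l.
Proof. by move=> uv ul e /ul[N uN]; exists N => n /uN; rewrite uv. Qed.
End Tends.

Lemma tendsZ (R : realType) (V : normedModType R[i]) (u : nat -> V) l c :
  tends u l -> tends (fun n => c *: u n) (c *: l).
Proof.
move=> ul e e0; have c0 := nrm_ge0 c.
have [|N uN] := ul (e / (nrm c + 1)); first by rewrite divr_gt0 // ltr_wpDl.
exists N => n /uN h; rewrite -scalerBr nrmZ.
apply: le_trans (_ : (nrm c + 1) * (e / (nrm c + 1)) <= _).
  by apply: ler_pM; rewrite ?nrm_ge0 // lerDl.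
by rewrite mulrCA divff ?mulr1 // gt_eqF // ltr_wpDl.
Qed.

Section PoleCell.
Variable R : realType.
Local Notation C := R[i].

(** The scalar case of [cell_resolvent]. *)
Lemma pole_cell j a b (z : C) (r : R) : 0 < r ->
    (forall x, in_cell j a b x -> r <= nrm (x - z)) ->
  nrm (cell j (fun x => (x - z)^-1 : C^o) a b) <= mesh R j ^+ 4 * r^-1 ^+ 4.
Proof.
move=> r0 far; set h := (mesh R j)%:C%C.
pose x1 := hmid R j a b - z; pose x2 := vmid R j a.+1 b - z.
pose x3 := hmid R j a b.+1 - z; pose x4 := vmid R j a b - z.
have far1 : r <= nrm x1 by apply: far; exact: hmid_in_cell.
have far2 : r <= nrm x2 by apply: far; exact: vmid_in_cell_left.
have far3 : r <= nrm x3 by apply: far; exact: hmid_in_cell_below.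
have far4 : r <= nrm x4 by apply: far; exact: vmid_in_cell.
have nz x : r <= nrm x -> x != 0 :> C.
  by move=> rx; apply: contraTneq rx => ->; rewrite nrm0 -ltNge.
have [n1 n2 n3 n4] := And4 (nz _ far1) (nz _ far2) (nz _ far3) (nz _ far4).
have e13 : x1 - x3 = - ('i%C * h) by rewrite -(cell_midpoints_vert R j a b) /x1 /x3; ring.
have e24 : x2 - x4 = h by rewrite -[RHS](cell_midpoints_hor R j a b) /x2 /x4; ring.
have ep : x1 * x3 - x2 * x4 = (mesh R j ^+ 2 / 2)%:C%C.
  rewrite -(cell_midpoints_prod R j a b) /x1 /x2 /x3 /x4.
  have := cell_midpoints_sum R j a b; set m1 := hmid _ _ _ _; set m3 := hmid _ _ _ _.
  set m2 := vmid _ _ _ _; set m4 := vmid _ _ _ _ => sE.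
  have -> : (m1 - z) * (m3 - z) - (m2 - z) * (m4 - z) =
     m1 * m3 - m2 * m4 - z * ((m1 + m3) - (m2 + m4)) by ring.
  by rewrite sE subrr mulr0 subr0.
have inv_nrm x : r <= nrm x -> nrm (x^-1 : C) <= r^-1.
  by move=> rx; rewrite nrmV lef_pV2 ?posrE // (lt_le_trans r0).
have -> : cell j (fun x => (x - z)^-1 : C^o) a b =
    - ('i%C * h * h * (x1 * x3 - x2 * x4)) * (x1^-1 * (x2^-1 * (x3^-1 * x4^-1))).
  rewrite /cell /circulation -/h -/x1 -/x2 -/x3 -/x4 /GRing.scale /=.
  have -> : h * x1^-1 + 'i%C * h * x2^-1 - h * x3^-1 - 'i%C * h * x4^-1 =
     - h * (x1 - x3) * (x1^-1 * x3^-1) - 'i%C * h * (x2 - x4) * (x2^-1 * x4^-1).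
    by field; rewrite n1 n2 n3 n4.
  by rewrite e13 e24; field; rewrite n1 n2 n3 n4.
rewrite nrmM nrmN !nrmM nrm_i mul1r nrm_mesh ep nrm_real.
set k := mesh R j; have k0 : 0 < k := mesh_gt0 R j.
have k2 : `|k ^+ 2 / 2| <= k ^+ 2.
  by rewrite ger0_norm ?divr_ge0 ?exprn_ge0 ?(ltW k0) // ler_pdivrMr // ler_peMr ?exprn_ge0 ?(ltW k0) // ler1n.
have i1 := inv_nrm _ far1; have i2 := inv_nrm _ far2.
have i3 := inv_nrm _ far3; have i4 := inv_nrm _ far4.
apply: ler_pM; rewrite ?mulr_ge0 ?nrm_ge0 ?(ltW k0) ?normr_ge0 //.
  have -> : k ^+ 4 = k * k * k ^+ 2 by ring.
  by rewrite ler_wpM2l // mulr_ge0 ?(ltW k0).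
have -> : r^-1 ^+ 4 = r^-1 * (r^-1 * (r^-1 * r^-1)) by ring.
by do 3! (apply: ler_pM; rewrite ?mulr_ge0 ?nrm_ge0 //).
Qed.
End PoleCell.

Section Riesz.
Variable R : realType.
Local Notation C := R[i].
Variable X : completeNormedModType C.
Variable T : {linear X -> X}.

Definition contour_op j w (g : C -> C) (y : X) := contour j w (fun z => g z *: resolvent T z y).

Lemma contour_op_linear j w g : linear (contour_op j w g).
Proof.
move=> c x y; rewrite /contour_op -contourZ -contourD.
congr contour; apply/funext => z.
by rewrite linearP scalerDr !scalerA mulrC.
Qed.
HB.instance Definition _ j w g := GRing.isLinear.Build C X X _ (contour_op j w g) (contour_op_linear j w g).

Lemma contour_scalar j w (g : C -> C) (y : X) :
  contour j w (fun z => g z *: y) = (contour j w (g : C -> C^o) : C) *: y.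
Proof.
rewrite /contour scaler_suml; apply: eq_bigr => a _; rewrite scaler_suml; apply: eq_bigr => b _.
by rewrite /cell /circulation -[RHS]scalerA !scalerBl scalerDl -!scalerA.
Qed.

(** [c + E] is invertible, so [T - z] has [S (c + E) ^ (- 1)] as a right inverse,
    and it is injective because [S (T - z) = c + E]. *)
Lemma resolvent_of_approximate_inverse z (c : C) (S E : {linear X -> X}) B :
    c != 0 -> op_bound S B -> 0 <= B -> op_bound E (nrm c / 2) ->
    (forall y, T (S y) - z *: S y = c *: y + E y) ->
    (forall y, S (T y - z *: y) = c *: y + E y) ->
  resolvent_set T z.
Proof.
move=> c0 SB B0 E2 TS ST.
have nc0 : 0 < nrm c by rewrite lt_neqAle nrm_ge0 andbT eq_sym; apply: contraNneq c0 => /nrm_eq0->.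
pose A : {linear X -> X} := (- c^-1) \*: E.
have AE y : y - A y = c^-1 *: (c *: y + E y).
  by rewrite scalerDr scalerA mulVf // scale1r /A /= scaleNr opprK.
have A2 : op_bound A 2^-1.
  move=> y; rewrite /A /= nrmZ nrmN nrmV; apply: le_trans (ler_wpM2l _ (E2 y)) _.
    by rewrite invr_ge0 nrm_ge0.
  by rewrite !mulrA mulVf ?gt_eqF // mul1r.
have [V [V1 V2 Vb]] := contraction_inverse A2.
have right_inv : cancel (fun y => c^-1 *: S (V y)) (fun x => T x - z *: x).
  move=> y; rewrite linearZ /= scalerA [z * _]mulrC -scalerA -scalerBr TS -AE.
  exact: V2.
have inj0 x : T x - z *: x = 0 -> x = 0.
  move=> /(congr1 S); rewrite linear0 ST => /(congr1 (fun v => c^-1 *: v)).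
  rewrite -AE scaler0 => A0; have := V1 x; rewrite A0 => <-.
  by have := V1 0; rewrite linear0 subr0.
apply: (@resolvent_setP _ _ T z (fun y => c^-1 *: S (V y)) ((nrm c)^-1 * B * 2)) => //.
- move=> x; set y := c^-1 *: _; have := right_inv (T x - z *: x); rewrite /= -/y => E1.
  apply/eqP; rewrite -subr_eq0; apply/eqP; apply: inj0.
  by rewrite linearB scalerBr opprD opprK addrACA E1 addrACA subrr add0r addNr.
- move=> y; rewrite nrmZ nrmV -!mulrA; apply: ler_wpM2l; first by rewrite invr_ge0 nrm_ge0.
  by apply: le_trans (SB _) _; apply: ler_wpM2l => //; apply: Vb.
Qed.

Variable K : C -> Prop.
Variable d : R.
Definition near_K e z := exists2 k, K k & nrm (z - k) <= e.
Definition far_K e z := forall k, K k -> e <= nrm (z - k).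
Hypothesis K_disk : forall k, K k -> nrm k <= 1.
Hypothesis d0 : 0 < d.
Hypothesis d1 : d <= 1.

(** The points at which the resolvent is evaluated: within [d] of [K], but not
    within [e / 4]. *)
Definition shell e z := near_K d z /\ far_K (e / 4) z.

(** The region [w] contains the cells close to [K] and avoids those far from [K];
    the cells at intermediate distance are on either side. *)
Definition separates e j (w : nat -> nat -> bool) :=
  forall a b z, in_cell j a b z -> if w a b then near_K e z else far_K (e / 4) z.

Lemma separates_refine e j w : separates e j w -> separates e j.+1 (refine w).
Proof. by move=> h a b z /in_cell_half; apply: h. Qed.

Lemma separates_iter e j w i : separates e j w -> separates e (j + i) (iter i refine w).
Proof. by move=> h; elim: i => [|i IH]; rewrite ?addn0 // addnS; apply: separates_refine. Qed.

Lemma near_K_le e e' z : e <= e' -> near_K e z -> near_K e' z.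
Proof. by move=> le_e [k Kk h]; exists k => //; apply: le_trans le_e. Qed.

Lemma far_K_le e e' z : e <= e' -> far_K e' z -> far_K e z.
Proof. by move=> le_e h k /h; apply: le_trans. Qed.

Lemma near_K_disk e z : e <= 1 -> near_K e z -> nrm z <= 2.
Proof.
move=> e1 [k /K_disk k1 zk]; have := nrmD (z - k) k; rewrite subrK; lra.
Qed.

Lemma center_in_cell j a b : in_cell j a b (center R j a b).
Proof.
have h := mesh_gt0 R j; rewrite /in_cell /= (natrS R a) (natrS R b).
by apply/andP; split; apply/andP; split; lra.
Qed.

Lemma in_cell_center j a b z : in_cell j a b z -> nrm (z - center R j a b) <= mesh R j.
Proof.
rewrite /in_cell (natrS R a) (natrS R b) => /andP[/andP[h1 h2] /andP[h3 h4]].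
apply: le_trans (nrm_ReIm _) _.
have -> : mesh R j = mesh R j / 2 + mesh R j / 2 by field.
by case: z h1 h2 h3 h4 => x y /= *; apply: lerD; rewrite ler_norml; lra.
Qed.

Lemma separates_frame e j w : e <= d -> separates e j w -> vanish_on_frame (side j) w.
Proof.
move=> ed h; have h0 := mesh_gt0 R j; have h1 := mesh_le1 R j; have sh := mesh_side R j.
have small a b : w a b -> `|Re (center R j a b)| <= 2 /\ `|Im (center R j a b)| <= 2.
  move=> wab; have := h a b _ (center_in_cell j a b); rewrite wab => /(near_K_disk (le_trans ed d1)) n2.
  by split; apply: le_trans n2; [apply: nrm_Re | apply: nrm_Im].
by move=> c; split; apply/negP => /small[]; rewrite /= !ler_norml ?mulrDl ?sh; lra.
Qed.

Lemma separates_cuts e j w : 0 < e -> e <= d -> separates e j w -> cuts_in (shell e) j w.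
Proof.
move=> e0 ed h; split; first exact: separates_frame ed h.
  move=> a b z ne z1 z2; have := h a b z z1; have := h a b.+1 z z2.
  by case: (w a b) ne; case: (w a b.+1) => //= _ h1 h2; split => //; apply: near_K_le ed _.
move=> a b z ne z1 z2; have := h a b z z1; have := h a.+1 b z z2.
by case: (w a b) ne; case: (w a.+1 b) => //= _ h1 h2; split => //; apply: near_K_le ed _.
Qed.

Lemma exists_separates e J : 0 < e -> exists j w, (J <= j)%N /\ separates e j w.
Proof.
move=> e0; have e8 : 0 < e / 8 by rewrite divr_gt0.
have [N sm] := mesh_small 1 e8; pose j := maxn J N.
have hj : mesh R j < e / 8 by rewrite -[mesh R j]mul1r; apply: sm; rewrite leq_maxr.
exists j, (fun a b => `[<near_K (e / 2) (center R j a b)>]); split; first by rewrite leq_maxl.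
move=> a b z /in_cell_center zc; case: asboolP => [[k Kk kc]|nn].
  by exists k => //; apply: le_trans (nrm_triangle (center R j a b) _ _) _; lra.
move=> k Kk; rewrite leNgt; apply/negP => zk; apply: nn; exists k => //.
by apply: le_trans (nrm_triangle z _ _) _; rewrite nrm_distC; lra.
Qed.

Lemma variation_iter n w i : (variation (2 ^ i * n) (iter i refine w) = 2 ^ i * variation n w)%N.
Proof.
elim: i => [|i IH]; first by rewrite !mul1n.
by rewrite expnS -mulnA variation_refine IH mulnA.
Qed.

(** The length of the boundary of [w]; it is unchanged by refinement. *)
Definition cut_length j w : R := mesh R j * (variation (side j) w)%:R.

Lemma side_add j i : side (j + i) = (2 ^ i * side j)%N.
Proof. by rewrite /side expnD mulnA mulnC. Qed.

Lemma cut_length_refine j w i : cut_length (j + i) (iter i refine w) = cut_length j w.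
Proof.
rewrite /cut_length side_add variation_iter natrM natrX /mesh exprD.
rewrite [X in X * _ = _]mulrC mulrACA [X in X * _ = _](_ : _ = 1) ?mul1r //.
by rewrite exprVn mulVf // expf_neq0.
Qed.

Lemma cut_length_ge0 j w : 0 <= cut_length j w.
Proof. by rewrite mulr_ge0 ?ler0n // ltW // mesh_gt0. Qed.

Lemma mesh_add_le j i : mesh R (j + i) <= mesh R i.
Proof.
have -> : mesh R (j + i) = mesh R j * mesh R i by rewrite /mesh exprD.
by rewrite ler_piMl ?mesh_le1 // ltW // mesh_gt0.
Qed.

(** Two regions that separate [K] differ by cells inside the shell, each of which
    contributes [O(mesh ^ 4)]; there are [O(1 / mesh ^ 2)] cells. *)
Lemma separates_contourB e e' j w w' M y : 0 < e -> e <= e' -> e' <= d -> separates e j w -> separates e' j w' ->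
    0 < M -> (forall z, shell e z -> resolvent_set T z /\ op_bound (resolvent T z) M) ->
  nrm (contour j w (fun z => resolvent T z y) - contour j w' (fun z => resolvent T z y))
    <= 36 * (M ^+ 4 * nrm y) * mesh R j ^+ 2.
Proof.
move=> e0 ee' e'd hw hw' M0 gM; set f := fun z => resolvent T z y.
have h0 := mesh_gt0 R j.
have -> : contour j w f - contour j w' f =
  \sum_(a < side j) \sum_(b < side j) (bool_coef R (w a b) - bool_coef R (w' a b)) *: cell j f a b.
  rewrite /contour -sumrB; apply: eq_bigr => a _; rewrite -sumrB; apply: eq_bigr => b _.
  by rewrite scalerBl.
set D := mesh R j ^+ 4 * (M ^+ 4 * nrm y).
have D0 : 0 <= D.
  exact: mulr_ge0 (exprn_ge0 _ (ltW h0)) (mulr_ge0 (exprn_ge0 _ (ltW M0)) (nrm_ge0 _)).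
have term a b : nrm ((bool_coef R (w a b) - bool_coef R (w' a b)) *: cell j f a b) <= D.
  have [E|ne] := eqVneq (w a b) (w' a b); first by rewrite E subrr scale0r nrm0.
  have cellD : nrm (cell j f a b) <= D.
    apply: (cell_resolvent M0 gM) => z zc; have := hw a b z zc; have := hw' a b z zc.
    case: (w a b) ne; case: (w' a b) => //= _ h1 h2.
      by split; [apply: near_K_le h2; apply: le_trans e'd | apply: far_K_le h1; rewrite ler_pM2r].
    by split => //; apply: near_K_le h1.
  by case: (w a b) ne; case: (w' a b) => //= _; rewrite /bool_coef ?subr0 ?sub0r ?scaleN1r ?nrmN ?scale1r.
have -> : 36 * (M ^+ 4 * nrm y) * mesh R j ^+ 2 = \sum_(a < side j) \sum_(b < side j) D.
  rewrite !sumr_const !card_ord -mulrnA -[RHS]mulr_natr natrM /D.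
  have := mesh_side R j; set s := (side j)%:R; set h := mesh R j => sh.
  set m := M ^+ 4 * nrm y.
  have -> : h ^+ 4 * m * (s * s) = (s * h) ^+ 2 * m * h ^+ 2 by ring.
  by rewrite sh; ring.
apply: le_trans (nrm_sum _ _ _) _; apply: ler_sum => a _.
by apply: le_trans (nrm_sum _ _ _) _; apply: ler_sum => b _.
Qed.

Hypothesis resolvent_bound : forall e, 0 < e -> e <= d ->
  exists2 M, 0 < M & forall z, shell e z -> resolvent_set T z /\ op_bound (resolvent T z) M.

Definition contour_seq j w (f : C -> X) i := contour (j + i) (iter i refine w) f.

(** The limit [P] of the contour sums of the resolvent: up to the factor
    [- 2 pi i], the Riesz projection of [T] on [K]. *)
Lemma riesz_limit : exists (P : X -> X) j w c, 0 <= c /\ separates d j w /\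
  forall y i, nrm (contour_seq j w (fun z => resolvent T z y) i - P y) <= c * nrm y * mesh R i.
Proof.
have [M M0 gM] := resolvent_bound d0 (lexx d); have [j [w [_ hw]]] := exists_separates 0 d0.
pose c := cut_length j w * M ^+ 3; have c0 : 0 <= c := mulr_ge0 (cut_length_ge0 j w) (exprn_ge0 _ (ltW M0)).
have step y i : nrm (contour_seq j w (fun z => resolvent T z y) i.+1
                 - contour_seq j w (fun z => resolvent T z y) i) <= c * nrm y * mesh R i.
  have hwi := separates_cuts d0 (lexx d) (separates_iter (i := i) hw).
  rewrite /contour_seq addnS; apply: le_trans (contour_halving M0 gM y hwi) _.
  set h := mesh R (j + i); set v := (variation _ _)%:R; set m := M ^+ 3.
  have -> : h ^+ 3 * (m * nrm y) * v = (h * v * m) * nrm y * (h * h) by ring.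
  rewrite -[h * v]/(cut_length (j + i) (iter i refine w)) cut_length_refine -/m -/c.
  rewrite ler_wpM2l ?(mulr_ge0 c0 (nrm_ge0 _)) //.
  have h0 : 0 < h := mesh_gt0 R _; apply: le_trans (mesh_add_le j i); rewrite -/h.
  by rewrite ler_piMl ?(ltW h0) //; exact: (mesh_le1 R).
have [P PE] := choice (fun y => complete_geometric (step y)).
exists P, j, w, (2 * c); split; first by rewrite mulr_ge0.
by split=> // y i; have := PE y i; rewrite mulrA.
Qed.

(** The operator version of [root_prod]: the product of the [T - r]. *)
Definition root_op (rs : seq C) (y : X) := foldl (fun v r => T v - r *: v) y rs.

Section RieszOperator.
Variables (P : X -> X) (j0 : nat) (w0 : nat -> nat -> bool) (c0 : R).
Hypothesis c0_ge0 : 0 <= c0.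
Hypothesis sep0 : separates d j0 w0.
Hypothesis P_lim : forall y i,
  nrm (contour_seq j0 w0 (fun z => resolvent T z y) i - P y) <= c0 * nrm y * mesh R i.

(** The operator [P] can be computed along contours at any scale [e]; this is
    what makes sharp estimates possible. *)
Lemma riesz_tends e : 0 < e -> e <= d -> exists j w, separates e j w /\
  forall y, tends (contour_seq j w (fun z => resolvent T z y)) (P y).
Proof.
move=> e0 ed; have [M M0 gM] := resolvent_bound e0 ed.
have [j [w [le_j hw]]] := exists_separates j0 e0; exists j, w; split => // y.
have [t jE] : exists t, j = (j0 + t)%N by exists (j - j0)%N; rewrite subnKC.
apply: (@tends_geometric _ _ _ _ (36 * (M ^+ 4 * nrm y) + c0 * nrm y)) => i.
have E : (j + i = j0 + (t + i))%N by rewrite jE addnA.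
have hw' := separates_iter (i := t + i) sep0; rewrite -E in hw'.
have h1 := separates_contourB y e0 ed (lexx d) (separates_iter (i := i) hw) hw' M0 gM.
have h2 := P_lim y (t + i); rewrite /contour_seq -E in h2.
apply: le_trans (nrm_triangle _ _ _) (le_trans (lerD h1 h2) _).
have m0 := mesh_gt0 R (j + i); have mi := mesh_add_le j i; have mt := mesh_add_le t i.
have m4 : 0 <= 36 * (M ^+ 4 * nrm y).
  exact: mulr_ge0 (ler0n _ 36) (mulr_ge0 (exprn_ge0 _ (ltW M0)) (nrm_ge0 _)).
rewrite [leRHS]mulrDl; apply: lerD; rewrite ler_wpM2l ?(mulr_ge0 c0_ge0 (nrm_ge0 _)) //.
by apply: le_trans mi; rewrite expr2 ler_piMl ?(ltW m0) //; exact: (mesh_le1 R).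
Qed.

Lemma shell_resolvent e z : 0 < e -> e <= d -> shell e z -> resolvent_set T z.
Proof. by move=> e0 ed gz; have [M _ gM] := resolvent_bound e0 ed; have [] := gM z gz. Qed.

(** As [resolvent z (T y - r *: y) = (z - r) *: resolvent z y + y], applying
    [T - r] multiplies the integrand by [z - r], up to a polynomial in [z], whose
    contour sums tend to zero. *)
Lemma riesz_root_op e j w rs y : 0 < e -> e <= d -> separates e j w ->
    (forall y, tends (contour_seq j w (fun z => resolvent T z y)) (P y)) ->
  tends (contour_seq j w (fun z => root_prod rs z *: resolvent T z y)) (P (root_op rs y)).
Proof.
move=> e0 ed hw Pt; have cuts i := separates_cuts e0 ed (separates_iter (i := i) hw).
elim: rs y => [|r rs IH] y.
  apply: eq_tends (Pt y) => i; rewrite /contour_seq; congr contour; apply/funext => z.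
  by rewrite /root_prod big_nil scale1r.
have [B gB] := contour_smooth_le (smooth_root_prod rs).
have poly0 : tends (contour_seq j w (fun z => root_prod rs z *: y)) 0.
  apply: (@tends_geometric _ _ _ _ (B * nrm y)) => i; rewrite subr0 /contour_seq contour_scalar nrmZ.
  have B0 : 0 <= B.
    have := le_trans (nrm_ge0 _) (gB 0%N (fun _ _ => false)).
    by rewrite /mesh expr0 mulr1.
  rewrite mulrAC ler_wpM2r ?nrm_ge0 //; apply: le_trans (gB _ _) _.
  by rewrite ler_wpM2l // mesh_add_le.
have := tendsD (IH (T y - r *: y)) (tendsN poly0); rewrite subr0 /=.
apply: eq_tends => i; rewrite /contour_seq.
rewrite -[X in _ + X = _]scaleN1r -contourZ -contourD; apply: (eq_contour (cuts i)) => z gz.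
have [_ rT _] := resolventP (shell_resolvent e0 ed gz).
rewrite root_prod_cons linearB linearZ /= rT addrAC -scalerBl scalerDr scalerA.
by rewrite [(z - r) * _]mulrC scaleN1r addrK.
Qed.

Lemma riesz_bound e : 0 < e -> e <= d -> exists2 B, 0 <= B &
  forall rs y c, 0 <= c -> (forall z, near_K e z -> nrm (root_prod rs z) <= c) ->
  nrm (P (root_op rs y)) <= B * c * nrm y.
Proof.
move=> e0 ed; have [M M0 gM] := resolvent_bound e0 ed; have [j [w [hw Pt]]] := riesz_tends e0 ed.
have cuts i := separates_cuts e0 ed (separates_iter (i := i) hw).
exists (M * cut_length j w); first exact: mulr_ge0 (ltW M0) (cut_length_ge0 j w).
move=> rs y c c_ge0 rs_le; apply: (tends_le (riesz_root_op rs y e0 ed hw Pt)) => i.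
have cM : 0 <= c * (M * nrm y) := mulr_ge0 c_ge0 (mulr_ge0 (ltW M0) (nrm_ge0 _)).
pose near_cut z := near_K e z /\ shell e z.
have cuts' : cuts_in near_cut (j + i) (iter i refine w).
  have hwi := separates_iter (i := i) hw; case: (cuts i) => fr ch cv; split => //.
    move=> a b z ne z1 z2; split; last exact: ch ne z1 z2.
    by have := hwi a b z z1; have := hwi a b.+1 z z2; case: (iter _ _ _ a b) ne; case: (iter _ _ _ a b.+1).
  move=> a b z ne z1 z2; split; last exact: cv ne z1 z2.
  by have := hwi a b z z1; have := hwi a.+1 b z z2; case: (iter _ _ _ a b) ne; case: (iter _ _ _ a.+1 b).
apply: le_trans (contour_bound cuts' cM _) _.
  move=> z [nz gz]; rewrite nrmZ; apply: ler_pM; rewrite ?nrm_ge0 ?rs_le //.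
  by have [_ /(_ y)] := gM z gz.
rewrite -/(cut_length (j + i) (iter i refine w)) cut_length_refine.
by have -> : c * (M * nrm y) * cut_length j w = M * cut_length j w * c * nrm y by ring.
Qed.

Lemma riesz_linear : linear P.
Proof.
move=> a x y; have [j [w [hw Pt]]] := riesz_tends d0 (lexx d).
apply: tends_unique (Pt _) _.
apply: eq_tends (tendsD (tendsZ a (Pt x)) (Pt y)) => i.
rewrite /contour_seq -contourZ -contourD; congr contour; apply/funext => z.
by rewrite linearP.
Qed.

(** If [P] vanished, the contour sum [S] of [(x - z)^-1 *: resolvent x] would
    satisfy [(T - z) S = c + E], where [E], a contour sum of the resolvent, tends
    to zero and [c], the contour sum of [(x - z)^-1], does not: then [z] would be
    in the resolvent set. *)
Lemma riesz_neq0 z : K z -> ~ resolvent_set T z -> exists y, P y != 0.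
Proof.
move=> Kz nres; apply/not_existsP => P0; apply: nres.
have {}P0 y : P y = 0 by apply/eqP; apply: contrapT => /negP; exact: P0.
have [M M0 gM] := resolvent_bound d0 (lexx d).
have cuts i := separates_cuts d0 (lexx d) (separates_iter (i := i) sep0).
have z1 := K_disk Kz.
pose g (x : C) := (x - z)^-1.
have d40 : 0 < d / 4 by rewrite divr_gt0.
pose B4 := (d / 4)^-1 ^+ 4.
have [N1 sm1] := mesh_small (4 * c0) (ltr01 : 0 < (1 : R)).
have [N2 sm2] := mesh_small (72 * B4) (ltr01 : 0 < (1 : R)).
pose i := maxn N1 N2; pose j := (j0 + i)%N; pose w := iter i refine w0.
have admw : separates d j w := separates_iter (i := i) sep0.
have mi := mesh_gt0 R i.
have m1 : 4 * c0 * mesh R i < 1 by apply: sm1; rewrite leq_maxl.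
have m2 : 72 * B4 * mesh R i < 1 by apply: sm2; rewrite leq_maxr.
pose c : C := contour j w (g : C -> C^o).
have c_ge : 2^-1 <= nrm c.
  have [Rz Iz] : `|Re z| <= 1 /\ `|Im z| <= 1.
    by split; apply: le_trans z1; [exact: nrm_Re | exact: nrm_Im].
  have := total_pole j Rz Iz.
  set tot := (X in Im X); pose rest : C := contour j (fun a b => ~~ w a b) (g : C -> C^o).
  have -> : tot = c + rest.
    rewrite /tot /c /rest /contour -big_split; apply: eq_bigr => a _.
    rewrite -big_split; apply: eq_bigr => b _; rewrite /= -scalerDl.
    by case: (w a b); rewrite /bool_coef ?addr0 ?add0r scale1r.
    (* The cells outside the region stay away from [z]. *)
have rest_le : nrm rest <= 2^-1.
    apply: (@le_trans _ _ (36 * B4 * mesh R j ^+ 2)).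
      have h0 := mesh_gt0 R j.
      have -> : 36 * B4 * mesh R j ^+ 2 = \sum_(a < side j) \sum_(b < side j) (mesh R j ^+ 4 * B4).
        rewrite !sumr_const !card_ord -mulrnA -[RHS]mulr_natr natrM.
        have := mesh_side R j; set s := (side j)%:R; set h := mesh R j => sh.
        have -> : h ^+ 4 * B4 * (s * s) = (s * h) ^+ 2 * B4 * h ^+ 2 by ring.
        by rewrite sh; ring.
      apply: le_trans (nrm_sum _ _ _) _; apply: ler_sum => a _.
      apply: le_trans (nrm_sum _ _ _) _; apply: ler_sum => b _.
      have B40 : 0 <= mesh R j ^+ 4 * B4.
        apply: mulr_ge0 (exprn_ge0 _ (ltW h0)) (exprn_ge0 _ _).
        by rewrite invr_ge0 ltW.
      have := admw a b; case: (w a b) => farw; first by rewrite /bool_coef scale0r nrm0.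
      by rewrite /bool_coef scale1r; apply: pole_cell => // x /farw/(_ z Kz).
    have B40 : 0 <= B4 by apply: exprn_ge0; rewrite invr_ge0 ltW.
    have mj := mesh_gt0 R j; have mji : mesh R j <= mesh R i := mesh_add_le j0 i.
    have mj1 := mesh_le1 R j.
    apply: (@le_trans _ _ (36 * B4 * mesh R i)); last by lra.
    apply: ler_wpM2l; first exact: mulr_ge0 (ler0n _ 36) B40.
    apply: le_trans mji.
    by rewrite expr2 ler_piMl ?(ltW mj).
  rewrite ImD => t1; have := nrm_Im rest; rewrite ler_norml => /andP[_ r1].
  by apply: le_trans (nrm_Im c); apply: le_trans (ler_norm _); lra.
have c_neq0 : c != 0.
  by apply: contraTneq c_ge => ->; rewrite nrm0 -ltNge invr_gt0.
have far_z x : shell d x -> d / 4 <= nrm (x - z) by move=> [_ /(_ z Kz)].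
have g_mul x : shell d x -> (x - z) * g x = 1.
  move=> /far_z dx; rewrite /g divff //; apply: contraTneq dx => ->.
  by rewrite nrm0 -ltNge.
have cutsj : cuts_in (shell d) j w := cuts i.
pose S : {linear X -> X} := contour_op j w g.
pose E : {linear X -> X} := contour_op j w (fun=> 1).
have SE y : S y = contour j w (fun x => g x *: resolvent T x y) by [].
have EE y : E y = contour j w (fun x => resolvent T x y).
  by rewrite /= /contour_op; congr contour; apply/funext => x; rewrite scale1r.
have E_le : op_bound E (nrm c / 2).
  move=> y; rewrite EE.
  have := P_lim y i; rewrite P0 subr0 => /le_trans; apply.
  rewrite mulrAC ler_wpM2r ?nrm_ge0 //; move: c_ge m1; lra.
have B_ge0 : 0 <= (d / 4)^-1 * M * cut_length j w.
  by rewrite mulr_ge0 ?cut_length_ge0 // mulr_ge0 ?(ltW M0) // invr_ge0 ltW.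
have g_le x : shell d x -> nrm (g x) <= (d / 4)^-1.
  by move=> /far_z dx; rewrite /g nrmV lef_pV2 ?posrE // (lt_le_trans d40).
apply: (@resolvent_of_approximate_inverse z c S E _ c_neq0 _ B_ge0 E_le).
- move=> y; rewrite SE.
  have dM : 0 <= (d / 4)^-1 * (M * nrm y).
    by rewrite mulr_ge0 ?invr_ge0 ?(ltW d40) // mulr_ge0 ?nrm_ge0 // ltW.
  apply: le_trans (contour_bound cutsj dM _) _.
    move=> x gx; rewrite nrmZ; apply: ler_pM; rewrite ?nrm_ge0 ?g_le //.
    by have [_ /(_ y)] := gM x gx.
  rewrite -/(cut_length j w) le_eqVlt; apply/orP; left; apply/eqP; ring.
- move=> y; rewrite !SE EE contour_linear -contourZ -scaleN1r -contourZ.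
  rewrite -contour_scalar -!contourD; apply: (eq_contour cutsj) => x gx.
  have [Tr _ _] := resolventP (shell_resolvent d0 (lexx d) gx).
  rewrite linearZ /= Tr scaleN1r scalerDr !scalerA addrAC -scalerBl.
  by rewrite [z * _]mulrC -mulrBr [g x * _]mulrC g_mul // scale1r addrC.
- move=> y; rewrite !SE EE.
  rewrite -contour_scalar -!contourD; apply: (eq_contour cutsj) => x gx.
  have [_ rT _] := resolventP (shell_resolvent d0 (lexx d) gx).
  rewrite linearB linearZ /= rT addrAC -scalerBl scalerDr scalerA [g x * _]mulrC g_mul //.
  by rewrite scale1r addrC.
Qed.
End RieszOperator.
End Riesz.

(** * Separating functionals *)

(** The Hahn-Banach theorem is obtained from minimal sublinear functionals, which
    turn out to be linear. *)
Section HahnBanach.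
Variable R : realType.
Local Notation C := R[i].
Variable X : normedModType C.
Implicit Types (p q : X -> R) (x y v : X).

Definition sublinear p := (forall x y, p (x + y) <= p x + p y) /\
  (forall (t : R) x, 0 < t -> p (t%:C%C *: x) <= t * p x).

Lemma sublinearZ p (t : R) x : sublinear p -> 0 <= t -> p (t%:C%C *: x) = t * p x.
Proof.
case=> _ pZ; rewrite le_eqVlt => /orP[/eqP <-|t0].
  rewrite scale0r mul0r; have h1 := pZ 2 0 (ltr0n _ 2); rewrite scaler0 in h1.
  have h2 : p 0 <= 2^-1 * p 0 by have := pZ 2^-1 0; rewrite scaler0; apply; rewrite invr_gt0.
  by apply/eqP; rewrite eq_le; apply/andP; split; lra.
apply/eqP; rewrite eq_le pZ //=; have ti0 : 0 < t^-1 by rewrite invr_gt0.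
have := pZ t^-1 (t%:C%C *: x) ti0; rewrite scalerA -rmorphM /= mulVf ?gt_eqF // scale1r.
by rewrite -ler_pdivrMl ?invr_gt0 // invrK.
Qed.

Lemma sublinear0 p : sublinear p -> p 0 = 0.
Proof. by move=> ps; have := sublinearZ 0 ps (lexx 0); rewrite scale0r mul0r. Qed.

Lemma sublinear_ge p x : sublinear p -> - p (- x) <= p x.
Proof. by move=> ps; have := ps.1 x (- x); rewrite subrr sublinear0 //; lra. Qed.

Definition dominated q p := forall x, q x <= p x.

Definition slack p y x := [set p (x + t%:C%C *: y) - t * p y | t in [set t : R | 0 <= t]].
(** The largest sublinear functional below [p] whose value at [- y] is at most
    [- p y]. *)
Definition tilt p y x := inf (slack p y x).

Lemma slack_lb p y x : sublinear p -> lbound (slack p y x) (- p (- x)).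
Proof.
move=> ps _ [t /= t0 <-]; have := ps.1 (x + t%:C%C *: y) (- x).
by rewrite addrAC subrr add0r sublinearZ //; lra.
Qed.

Lemma slack_has_inf p y x : sublinear p -> has_inf (slack p y x).
Proof.
move=> ps; split; last by exists (- p (- x)); apply: slack_lb.
by exists (p (x + 0%:C%C *: y) - 0 * p y), 0 => /=.
Qed.

Lemma tilt_le p y x t : sublinear p -> 0 <= t -> tilt p y x <= p (x + t%:C%C *: y) - t * p y.
Proof.
move=> ps t0; apply: ge_inf; last by exists t.
by exists (- p (- x)); apply: slack_lb.
Qed.

Lemma tilt_dominated p y : sublinear p -> dominated (tilt p y) p.
Proof.
by move=> ps x; apply: le_trans (tilt_le y x ps (lexx 0)) _; rewrite scale0r addr0 mul0r subr0.
Qed.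

Lemma tilt_sublinear p y : sublinear p -> sublinear (tilt p y).
Proof.
move=> ps; split=> [x1 x2|s x s0].
  rewrite -lerBlDr; apply: lb_le_inf; first by case: (slack_has_inf y x1 ps).
  move=> _ [t1 /= t10 <-]; rewrite lerBlDr -lerBlDl.
  apply: lb_le_inf; first by case: (slack_has_inf y x2 ps).
  move=> _ [t2 /= t20 <-].
  have := tilt_le y (x1 + x2) ps (addr_ge0 t10 t20).
  have := ps.1 (x1 + t1%:C%C *: y) (x2 + t2%:C%C *: y).
  by rewrite addrACA -scalerDl -rmorphD /=; lra.
rewrite -ler_pdivrMl //; apply: lb_le_inf; first by case: (slack_has_inf y x ps).
move=> _ [t /= t0 <-]; rewrite ler_pdivrMl //.
have := tilt_le y (s%:C%C *: x) ps (mulr_ge0 (ltW s0) t0).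
by rewrite rmorphM /= -scalerA -scalerDr (sublinearZ _ ps (ltW s0)); lra.
Qed.

Lemma minimal_sublinear p : sublinear p ->
  exists q, [/\ sublinear q, dominated q p
    & forall q', sublinear q' -> dominated q' q -> q' = q].
Proof.
move=> ps; pose S := {q : X -> R | sublinear q /\ dominated q p}.
pose le (s t : S) := `[<dominated (sval t) (sval s)>].
have [||||m m_max] := @Zorn S le.
- by move=> t; apply/asboolP => x.
- move=> r s t /asboolP h1 /asboolP h2; apply/asboolP => x.
  exact: le_trans (h2 x) (h1 x).
- move=> [s sP] [t tP] /asboolP/= h1 /asboolP/= h2.
  have E : s = t by apply/funext => x; apply/eqP; rewrite eq_le h1 h2.
  by subst t; congr exist; exact: Prop_irrelevance.
- move=> A chain; have [A0|/set0P[a Aa]] := eqVneq A set0.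
    by exists (exist _ p (conj ps (fun x => lexx (p x)))) => s; rewrite A0.
  pose V x := [set sval s x | s in A].
  have Vlb x : lbound (V x) (- p (- x)).
    move=> _ [s As <-]; case: (svalP s) => s1 s2.
    by apply: le_trans (sublinear_ge x s1); rewrite lerN2.
  have Vne x : V x !=set0 by exists (sval a x), a.
  have inf_le x s : A s -> inf (V x) <= sval s x.
    by move=> As; apply: ge_inf; [exists (- p (- x)) | exists s].
  pose q x := inf (V x).
  have qs : sublinear q.
    split=> [x y|t x t0].
      rewrite -lerBlDr; apply: lb_le_inf => // _ [s As <-].
      rewrite lerBlDr -lerBlDl; apply: lb_le_inf => // _ [t At <-].
      have [/asboolP st|/asboolP ts] := chain s t As At.
        have := inf_le (x + y) t At; have := (svalP t).1.1 x y; have := st x; rewrite /q; lra.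
      have := inf_le (x + y) s As; have := (svalP s).1.1 x y; have := ts y; rewrite /q; lra.
    rewrite -ler_pdivrMl //; apply: lb_le_inf => // _ [s As <-].
    rewrite ler_pdivrMl //; apply: le_trans (inf_le _ s As) _.
    exact: (svalP s).1.2.
  have qp : dominated q p.
    by move=> x; apply: le_trans (inf_le x a Aa) _; exact: (svalP a).2.
  exists (exist _ q (conj qs qp)) => s As; apply/asboolP => x /=; exact: inf_le.
case: (svalP m) => ms mp; exists (sval m); split => // q qs qm.
have qp : dominated q p by move=> x; apply: le_trans (qm x) (mp x).
have le_mq : le m (exist _ q (conj qs qp)) by apply/asboolP.
by have /(congr1 sval) := m_max _ le_mq.
Qed.

Lemma nrm_sublinear : sublinear (@nrm R X).
Proof.
split=> [x y|t x t0]; first exact: nrmD.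
by rewrite nrmZ nrm_real gtr0_norm.
Qed.

(** A minimal [p] equals its own [tilt] at every [y], whence [p x + p y <= p (x + y)].
    Starting from the tilt of the norm at [v] forces [nrm v <= p v]. *)
Lemma separating_functional v : v != 0 -> exists p : X -> R,
  [/\ forall x y, p (x + y) = p x + p y, forall (t : R) x, p (t%:C%C *: x) = t * p x,
      forall x, `|p x| <= nrm x & p v != 0].
Proof.
move=> v0; have ns := nrm_sublinear.
have [p [ps p_le p_min]] := minimal_sublinear (tilt_sublinear v ns).
have pD x y : p (x + y) = p x + p y.
  apply/eqP; rewrite eq_le ps.1 /=.
  have := tilt_le y x ps ler01.
  rewrite (p_min _ (tilt_sublinear y ps) (tilt_dominated y ps)) scale1r mul1r; lra.
have pN x : p (- x) = - p x.
  by have := pD x (- x); rewrite subrr sublinear0 //; lra.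
have p_nrm x : p x <= nrm x by apply: le_trans (p_le x) (tilt_dominated v ns x).
exists p; split => //.
- move=> t x; have [t0|t0] := leP 0 t; first exact: sublinearZ.
  have nt0 : 0 <= - t by rewrite oppr_ge0 ltW.
  by have := sublinearZ x ps nt0; rewrite rmorphN /= scaleNr pN; lra.
- by move=> x; rewrite ler_norml p_nrm andbT lerNl -pN -(nrmN x).
have := p_le (- v); rewrite pN => h; have := tilt_le v (- v) ns ler01.
rewrite scale1r addNr nrm0 mul1r => h2.
apply/negP => /eqP pv; rewrite pv oppr0 in h.
have : nrm v <= 0 by lra.
by apply/negP; rewrite -ltNge lt_neqAle nrm_ge0 andbT eq_sym; apply: contraNneq v0 => /nrm_eq0->.
Qed.

(** The usual complexification [p x - i p (i x)] of a real functional. *)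
Lemma complex_separating_functional v : v != 0 -> exists f : X -> C,
  [/\ forall x y, f (x + y) = f x + f y, forall c x, f (c *: x) = c * f x,
      forall x, nrm (f x) <= 2 * nrm x & f v != 0].
Proof.
move=> /separating_functional[p [pD pZ p_le pv]].
exists (fun x => Complex (p x) (- p ('i%C *: x))); split.
- by move=> x y; rewrite scalerDr !pD opprD.
- move=> [a b] x; have cE : Complex a b = a%:C%C + b%:C%C * 'i%C.
    by apply/eqP; rewrite eq_complex /= !(mulr0, mulr1, addr0, add0r, mul0r, subr0) !eqxx.
  have iE : 'i%C * (a%:C%C + b%:C%C * 'i%C) = a%:C%C * 'i%C + (- b)%:C%C :> C.
    by apply/eqP; rewrite eq_complex /= !(mulr0, mulr1, mul1r, addr0, add0r, mul0r, subr0, sub0r, oppr0) !eqxx.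
  have -> : 'i%C *: (Complex a b *: x) = a%:C%C *: ('i%C *: x) + (- b)%:C%C *: x.
    by rewrite scalerA cE iE scalerDl -scalerA.
  have -> : Complex a b *: x = a%:C%C *: x + b%:C%C *: ('i%C *: x).
    by rewrite cE scalerDl -scalerA.
  rewrite !pD !pZ; apply/eqP; rewrite eq_complex /=; apply/andP; split; apply/eqP; ring.
- move=> x; apply: le_trans (nrm_ReIm _) _; rewrite /= normrN.
  have := p_le ('i%C *: x); rewrite nrmZ nrm_i mul1r; have := p_le x; lra.
by apply: contraNneq pv => -[->].
Qed.
End HahnBanach.

(** * A functional adapted to a clopen part of the spectrum *)
Section BoxCompactness.
Variable R : realType.
Local Notation C := R[i].

Lemma segment_uniform (Q : nat -> R -> Prop) :
    (forall M M' x, (M <= M')%N -> Q M x -> Q M' x) ->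
    (forall x, -3 <= x <= 3 -> exists2 r, 0 < r & exists M, forall y, `|y - x| < r -> Q M y) ->
  exists M, forall x, -3 <= x <= 3 -> Q M x.
Proof.
move=> Qmono Qloc.
have /compact_near_coveringP cov := @segment_compact R (-3) 3.
have [|N _ NQ] := cov nat \oo Q _.
  move=> x; rewrite /= in_itv /= => /Qloc[r r0 [M MQ]].
  exists (ball x r, [set n | (M <= n)%N]) => /=.
    by split; [exact: nbhsx_ballx | exists M].
  move=> [y n] /= [xy Mn]; apply: Qmono Mn _; apply: MQ.
  by rewrite distrC.
by exists N => x x3; apply: (NQ N) => //=; rewrite in_itv.
Qed.

(** Compactness, in the form used below: a local bound on the square is uniform.
    It is obtained by applying the one-dimensional case to each coordinate. *)
Lemma box_uniform (Q : nat -> C -> Prop) :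
    (forall M M' z, (M <= M')%N -> Q M z -> Q M' z) ->
    (forall z, exists2 r, 0 < r & exists M, forall w, nrm (w - z) < r -> Q M w) ->
  exists M, forall z, nrm z <= 3 -> Q M z.
Proof.
move=> Qmono Qloc.
pose Q1 x M y := forall x', `|x' - x| < M.+1%:R^-1 -> Q M (Complex x' y).
have inv_small (r : R) : 0 < r -> exists M : nat, M.+1%:R^-1 < r.
  move=> r0; have ri : 0 <= r^-1 by rewrite invr_ge0 ltW.
  exists (Num.bound r^-1); rewrite -[ltRHS]invrK ltf_pV2 ?posrE ?ltr0n ?invr_gt0 //.
  by apply: lt_trans (archi_boundP ri) _; rewrite ltr_nat ltnS.
have inv_mono M M' : (M <= M')%N -> (M'.+1%:R^-1 : R) <= M.+1%:R^-1.
  by move=> le_M; rewrite lef_pV2 ?posrE ?ltr0n // ler_nat.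
have [M MQ] : exists M, forall x, -3 <= x <= 3 -> forall y, -3 <= y <= 3 -> Q M (Complex x y).
  apply: (@segment_uniform (fun M x => forall y, -3 <= y <= 3 -> Q M (Complex x y))).
    by move=> M M' x le_M h y /h; apply: Qmono.
  move=> x _; have [M MQ] : exists M, forall y, -3 <= y <= 3 -> Q1 x M y.
    apply: (@segment_uniform (Q1 x)) => [M M' y le_M h x' hx'|y _].
      by apply: (Qmono _ _ _ le_M); apply: h; apply: lt_le_trans hx' (inv_mono _ _ le_M).
    have [r r0 [M MQ]] := Qloc (Complex x y).
    have r20 : 0 < r / 2 by rewrite divr_gt0.
    have [M' M'r] := inv_small _ r20.
    exists (r / 2) => //; exists (maxn M M') => y' yy' x' xx'.
    apply: Qmono (leq_maxl _ _) _; apply: MQ; apply: le_lt_trans (nrm_ReIm _) _ => /=.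
    have xr : `|x' - x| < r / 2.
      by apply: lt_trans xx' (le_lt_trans _ M'r); apply: inv_mono; rewrite leq_maxr.
    by have -> : r = r / 2 + r / 2 by [field]; apply: ltrD.
  exists M.+1%:R^-1; first by rewrite invr_gt0.
  by exists M => x' xx' y y3; apply: MQ.
exists M => z z3; have := le_trans (nrm_Re z) z3; have := le_trans (nrm_Im z) z3.
by case: z {z3} => x y /=; rewrite !ler_norml => h1 h2; apply: MQ.
Qed.

Lemma open_nrm (A : set C) z : open A -> A z -> exists2 r, 0 < r & forall w, nrm (w - z) < r -> A w.
Proof.
move=> oA Az; have := open_nbhs_nbhs (conj oA Az); rewrite -nbhs_ballE => -[e /= e0 eA].
exists (Re e); first by move: e0; rewrite ltcE => /andP[].
by move=> w wz; apply: eA; rewrite ball_nrm // nrm_distC.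
Qed.
End BoxCompactness.

Section SpectralFunctional.
Variable R : realType.
Local Notation C := R[i].

Lemma root_prod_cat (rs rs' : seq C) z : root_prod (rs ++ rs') z = root_prod rs z * root_prod rs' z.
Proof. by rewrite /root_prod big_cat. Qed.

Lemma root_prod_nseq0 n (z : C) : root_prod (nseq n 0) z = z ^+ n.
Proof. by elim: n => [|n IH]; rewrite /root_prod ?big_nil // big_cons -/(root_prod _ _) IH subr0 exprS. Qed.

Lemma root_prod_flatten (ws : seq C) k z :
  root_prod (flatten (nseq k ws)) z = root_prod ws z ^+ k.
Proof.
by elim: k => [|k IH]; rewrite ?exprS /= ?root_prod_cat ?IH // /root_prod big_nil.
Qed.

Lemma root_prod_mem (ws : seq C) z : z \in ws -> root_prod ws z = 0.
Proof.
elim: ws => // w ws IH; rewrite in_cons root_prod_cons => /orP[/eqP->|/IH->].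
  by rewrite subrr mul0r.
by rewrite mulr0.
Qed.

Lemma smooth_lipschitz (g : C -> C) : smooth_on_ball g -> exists2 B, 0 < B &
  forall c w, nrm c <= 10 -> nrm (w - c) <= 1 ->
    nrm (g c) <= B /\ nrm (g w - g c) <= B * nrm (w - c).
Proof.
move=> [g' [B B0 gB]]; exists (2 * B + 1); first by rewrite ltr_wpDl // mulr_ge0.
move=> c w c10 wc; have wc10 : nrm (w - c) <= 10 by apply: le_trans wc _; rewrite ler1n.
have [h1 h2 h3] := gB c (w - c) c10 wc10; split; first by lra.
have {h1} : nrm (g w - g c - (w - c) * g' c) <= B * nrm (w - c) ^+ 2.
  by move: h1; rewrite [c + _]addrC subrK.
set u := nrm (w - c) in wc *; have u0 : 0 <= u := nrm_ge0 _.
move=> h1; have := nrmD (g w - g c - (w - c) * g' c) ((w - c) * g' c).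
rewrite subrK => h4; apply: le_trans h4 _; rewrite nrmM -/u.
have h5 : u * nrm (g' c) <= u * B by rewrite ler_wpM2l.
have h6 : B * u ^+ 2 <= B * u by rewrite ler_wpM2l // expr2 ler_piMl.
by rewrite [leRHS]mulrDl mul1r -mulrA; lra.
Qed.

Lemma geometric_small (rho B eta : R) : 0 <= rho < 1 -> 0 < eta -> 0 <= B ->
  exists M, forall J, (M <= J)%N -> B * rho ^+ J <= eta.
Proof.
move=> /andP[r0 r1] eta0 B0.
have : (fun n => B * rho ^+ n) @ \oo --> (0 : R).
  by apply: cvg_geometric; rewrite ger0_norm.
move=> /cvgrPdist_le /(_ eta eta0)[M _ MJ]; exists M => J /MJ /=.
by rewrite sub0r normrN ger0_norm // mulr_ge0 // exprn_ge0.
Qed.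

Lemma nat_above (r : R) : exists M : nat, r <= M.+1%:R.
Proof.
have [r0|r0] := leP 0 r; last by exists 0%N; rewrite (le_trans (ltW r0)).
by exists (Num.bound r); rewrite ltW // (lt_trans (archi_boundP r0)) // ltr_nat ltnS.
Qed.

Lemma inv_nat_below (r : R) : 0 < r -> exists M : nat, M.+1%:R^-1 <= r.
Proof.
move=> r0; have [M h] := nat_above r^-1; exists M.
by rewrite -[leRHS]invrK lef_pV2 ?posrE ?ltr0n ?invr_gt0.
Qed.

Variable X : completeNormedModType C.
Variable T : {linear X -> X}.
Variable K : set C.
Hypothesis K_spec : K `<=` spectrum T.
Hypothesis K_disk : forall k, K k -> nrm k <= 1.
Hypothesis K_closed : forall z, ~ K z -> exists2 r, 0 < r & forall w, nrm (w - z) < r -> ~ K w.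
Hypothesis K_open : forall z, K z -> exists2 r, 0 < r &
  forall w, nrm (w - z) < r -> spectrum T w -> K w.

Lemma separation_distance : exists d, [/\ 0 < d, d <= 2^-1 &
  forall k w, K k -> spectrum T w -> nrm (w - k) < 2 * d -> K w].
Proof.
pose Q (M : nat) z := K z -> forall w, spectrum T w -> nrm (w - z) < M.+1%:R^-1 -> K w.
have inv_mono M M' : (M <= M')%N -> (M'.+1%:R^-1 : R) <= M.+1%:R^-1.
  by move=> le_M; rewrite lef_pV2 ?posrE ?ltr0n // ler_nat.
have [M MQ] : exists M, forall z, nrm z <= 3 -> Q M z.
  apply: box_uniform => [M M' z le_M h Kz w sw wz|z].
    by apply: h => //; apply: lt_le_trans wz (inv_mono _ _ le_M).
  have [Kz|nKz] := pselect (K z); last first.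
    by have [r r0 rK] := K_closed nKz; exists r => //; exists 0%N => w /rK nKw Kw.
  have [r r0 rK] := K_open Kz; have r20 : 0 < r / 2 by rewrite divr_gt0.
  have [M Mr] := inv_nat_below r20; exists (r / 2) => //; exists M => z' zz' Kz' w sw wz'.
  apply: rK => //; apply: le_lt_trans (nrm_triangle z' _ _) _.
  by have -> : r = r / 2 + r / 2 by [field]; apply: ltrD => //; apply: lt_le_trans wz' Mr.
exists (M.+1%:R^-1 / 2); split; first by rewrite divr_gt0 // invr_gt0.
  by rewrite ler_pdivrMr // mulVf // invf_le1 // ler1n.
move=> k w Kk sw; rewrite mulrCA divff // mulr1 => wk.
by apply: (MQ k) => //; apply: le_trans (K_disk Kk) _; rewrite ler1n.
Qed.

(** Near a resolvent point the bound is that of the Neumann series; a spectral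
    point has a neighbourhood disjoint from the shell, since it is in [K] or far
    from [K]. *)
Lemma uniform_resolvent_bound d e : 0 < e -> e <= d -> d <= 2^-1 ->
    (forall k w, K k -> spectrum T w -> nrm (w - k) < 2 * d -> K w) ->
  exists2 M, 0 < M & forall z, shell K d e z -> resolvent_set T z /\ op_bound (resolvent T z) M.
Proof.
move=> e0 ed d2 sep.
pose Q (M : nat) z := shell K d e z -> resolvent_set T z /\ op_bound (resolvent T z) M.+1%:R.
have [M MQ] : exists M, forall z, nrm z <= 3 -> Q M z.
  apply: box_uniform => [M M' z le_M h gz|z].
    have [h1 h2] := h gz; split => // y; apply: le_trans (h2 y) _.
    by rewrite ler_wpM2r ?nrm_ge0 // ler_nat.
  have [rz|nrz] := pselect (resolvent_set T z).
    have [_ _ [M0 M00 M0z]] := resolventP rz; exists (2 * M0)^-1; first by rewrite invr_gt0 mulr_gt0.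
    have [M Mle] := nat_above (2 * M0); exists M => w wz gw.
    have [|rw hw] := resolvent_open rz M00 M0z (w := w).
      rewrite -ler_pdivlMr //; apply: ltW; apply: lt_le_trans wz _.
      by rewrite invfM.
    by split => // y; apply: le_trans (hw y) _; rewrite ler_wpM2r ?nrm_ge0.
  have e8 : 0 < e / 8 by rewrite divr_gt0.
  exists (e / 8) => //; exists 0%N => w wz [[k Kk wk] farw]; exfalso.
  have Kz : K z.
    apply: (sep k) => //; apply: le_lt_trans (nrm_triangle w _ _) _.
    by rewrite nrm_distC; lra.
  by have := farw z Kz; lra.
exists M.+1%:R => // z gz; apply: (MQ z) => //.
have [nz _] := gz; apply: (@le_trans _ _ 2); last by rewrite ler_nat.
by apply: near_K_disk nz; [exact: K_disk | lra].
Qed.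

(** First [J] is chosen so that the multiplier is at most [eta / 2] on [K]: near
    a point of [K] on the unit circle [root_prod ws] is small and the powers are
    bounded by 1 on [K], while near another point the powers decrease
    geometrically.  Then continuity gives [e], which depends on [J] because the
    powers may grow off [K]. *)
Lemma small_multiplier (ws : seq C) d eta : 0 < d -> 0 < eta ->
    (forall z, K z -> nrm z = 1 -> z \in ws) ->
  exists J e, [/\ 0 < e, e <= d &
    forall z, near_K K e z -> nrm (root_prod (nseq J 0 ++ ws) z) <= eta].
Proof.
move=> d0 eta0 wsK; have eta2 : 0 < eta / 2 by rewrite divr_gt0.
have [B B0 gB] := smooth_lipschitz (smooth_root_prod ws).
pose Q (M : nat) z := K z -> forall J, (M <= J)%N -> nrm (root_prod ws z) * nrm z ^+ J <= eta / 2.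
have [J JQ] : exists M, forall z, nrm z <= 3 -> Q M z.
  apply: box_uniform => [M M' z le_M h Kz J le_J|z].
    by apply: h => //; apply: leq_trans le_J.
  have [Kz|nKz] := pselect (K z); last first.
    by have [r r0 rK] := K_closed nKz; exists r => //; exists 0%N => w /rK nKw Kw.
  have z1 := K_disk Kz; have z10 : nrm z <= 10 by apply: le_trans z1 _; rewrite ler1n.
  have [zE|z_neq1] := eqVneq (nrm z) 1.
    have r0 : 0 < eta / 2 / B by rewrite !divr_gt0.
    exists (Num.min 1 (eta / 2 / B)); first by rewrite lt_min ltr01.
    exists 0%N => w; rewrite lt_min => /andP[wz1 wz] Kw J _.
    have [_] := gB z w z10 (ltW wz1); rewrite (root_prod_mem (wsK z Kz zE)) subr0 => gw.
    apply: (@le_trans _ _ (nrm (root_prod ws w))).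
      by rewrite ler_piMr ?nrm_ge0 // exprn_ile1 ?nrm_ge0 ?K_disk.
    apply: le_trans gw _; rewrite mulrC -ler_pdivlMr //; exact: ltW.
  have zlt : nrm z < 1 by rewrite lt_neqAle z_neq1.
  pose rho := (1 + nrm z) / 2; have z_ge0 := nrm_ge0 z.
  have rho01 : 0 <= rho < 1 by rewrite /rho; apply/andP; split; lra.
  have [M MJ] := geometric_small rho01 eta2 (ltW B0).
  exists ((1 - nrm z) / 2); first by rewrite divr_gt0 // subr_gt0.
  exists M => w wz Kw J le_J.
  have w10 : nrm w <= 10 by apply: le_trans (K_disk Kw) _; rewrite ler1n.
  have [gw _] : nrm (root_prod ws w) <= B /\ nrm (root_prod ws w - root_prod ws w) <= B * nrm (w - w).
    by apply: gB => //; rewrite subrr nrm0.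
  apply: le_trans (MJ J le_J); apply: ler_pM; rewrite ?nrm_ge0 ?exprn_ge0 ?nrm_ge0 //.
  rewrite lerXn2r ?nnegrE ?nrm_ge0 //; first by case/andP: rho01.
  by have := nrmD (w - z) z; rewrite subrK /rho; lra.
have [B' B'0 hB] := smooth_lipschitz (smooth_root_prod (nseq J 0 ++ ws)).
exists J, (Num.min (Num.min d 1) (eta / 2 / B')); split.
- by rewrite !lt_min d0 ltr01 !divr_gt0.
- by rewrite !ge_min lexx.
move=> z [k Kk]; rewrite !le_min => /andP[/andP[_ zk1] zk].
have k10 : nrm k <= 10 by apply: le_trans (K_disk Kk) _; rewrite ler1n.
have [_ h1] := hB k z k10 zk1.
have h2 : nrm (root_prod (nseq J 0 ++ ws) k) <= eta / 2.
  rewrite root_prod_cat root_prod_nseq0 mulrC nrmM nrmX; apply: (JQ k) => //.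
  by apply: le_trans (K_disk Kk) _; rewrite ler1n.
have h3 : B' * nrm (z - k) <= eta / 2 by rewrite mulrC -ler_pdivlMr.
have := nrmD (root_prod (nseq J 0 ++ ws) z - root_prod (nseq J 0 ++ ws) k) (root_prod (nseq J 0 ++ ws) k).
by rewrite subrK; lra.
Qed.

Lemma spectral_functional (ws : seq C) k0 : K k0 ->
    (forall z, K z -> nrm z = 1 -> z \in ws) ->
  exists phi : X -> C,
    [/\ (forall x y, phi (x + y) = phi x + phi y) /\ (forall c x, phi (c *: x) = c * phi x),
        exists2 B, 0 < B & forall x, nrm (phi x) <= B * nrm x,
        exists v, phi v != 0
      & forall eta, 0 < eta -> exists J B, 0 <= B /\ forall k y,
          nrm (phi (root_op T (nseq (J * k) 0 ++ flatten (nseq k ws)) y)) <= B * eta ^+ k * nrm y].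
Proof.
move=> Kk0 wsK; have [d [d0 d2 sep]] := separation_distance.
have d1 : d <= 1 by apply: le_trans d2 _; rewrite invf_le1 // ler1n.
have resolvent_bound e (e0 : 0 < e) (ed : e <= d) := uniform_resolvent_bound e0 ed d2 sep.
have [P [j [w [c [c0 [hw P_lim]]]]]] := riesz_limit K_disk d0 d1 resolvent_bound.
have Pbound e e0 ed := riesz_bound K_disk d1 resolvent_bound c0 hw P_lim (e := e) e0 ed.
have P_lin := riesz_linear d0 resolvent_bound c0 hw P_lim.
have [v Pv] := riesz_neq0 K_disk d0 d1 resolvent_bound hw P_lim Kk0 (K_spec Kk0).
have [f [fD fZ f_le fv]] := complex_separating_functional Pv.
have PD x y : P (x + y) = P x + P y.
  by have := P_lin 1 x y; rewrite !scale1r.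
have P0 : P 0 = 0 by have := PD 0 0; rewrite addr0 -[X in X = _]addr0 => /addrI/esym.
have PZ a x : P (a *: x) = a *: P x by have := P_lin a x 0; rewrite !addr0 P0 addr0.
exists (fun x => f (P x)); split.
- by split=> *; rewrite ?PD ?fD ?PZ ?fZ.
- have [B B0 PB] := Pbound d d0 (lexx d); exists (2 * B + 1); first by rewrite ltr_wpDl // mulr_ge0.
  move=> x; apply: le_trans (f_le _) _.
  have triv z : near_K K d z -> nrm (root_prod [::] z) <= 1 by rewrite /root_prod big_nil nrm1.
  have := PB [::] x 1 ler01 triv; rewrite mulr1 /= => h.
  have -> : (2 * B + 1) * nrm x = 2 * (B * nrm x) + nrm x by ring.
  by have := nrm_ge0 x; lra.
- by exists v.
move=> eta eta0; have [J [e [e0 ed small]]] := small_multiplier d0 eta0 wsK.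
have [B B0 PB] := Pbound e e0 ed; exists J, (2 * B); split; first by rewrite mulr_ge0.
move=> k y; apply: le_trans (f_le _) _; rewrite -!mulrA ler_wpM2l // mulrA.
apply: PB; first by rewrite exprn_ge0 // ltW.
move=> z /small; rewrite !root_prod_cat !root_prod_nseq0 root_prod_flatten exprM -exprMn nrmX => h.
by rewrite lerXn2r ?nnegrE ?nrm_ge0 // ltW.
Qed.
End SpectralFunctional.

(** * Visits of an orbit to a ball *)
Lemma moment_mulXn (F : fieldType) (s : nat -> F) (q : {poly F}) n :
  moment s (q * 'X^n) = moment (fun i => s (i + n)%N) q.
Proof.
rewrite -{1}[q]coefK poly_def mulr_suml moment_sum; apply: eq_bigr => i _.
by rewrite -scalerAl -exprD momentZ momentXn.
Qed.

Section Dynamics.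
Variable R : realType.
Local Notation C := R[i].
Variable X : completeNormedModType C.
Variable T : {linear X -> X}.
Variable norm_T : R.
Hypothesis norm_T_ge2 : 2 <= norm_T.
Hypothesis T_le : op_bound T norm_T.

Lemma norm_T_ge1 : 1 <= norm_T. Proof. by apply: le_trans norm_T_ge2; rewrite ler1n. Qed.
Lemma norm_T_ge0 : 0 <= norm_T. Proof. exact: le_trans ler01 norm_T_ge1. Qed.

Lemma iter_linear n : linear (iter n T).
Proof. by elim: n => [|n IH] a x y //=; rewrite IH linearP. Qed.

Lemma iter_le n x : nrm (iter n T x) <= norm_T ^+ n * nrm x.
Proof.
elim: n => [|n IH]; first by rewrite mul1r.
by apply: le_trans (T_le _) _; rewrite exprS -mulrA ler_wpM2l ?norm_T_ge0.
Qed.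

Variable phi : X -> C.
Hypothesis phiD : forall x y, phi (x + y) = phi x + phi y.
Hypothesis phiZ : forall c x, phi (c *: x) = c * phi x.
Variable norm_phi : R.
Hypothesis norm_phi_gt0 : 0 < norm_phi.
Hypothesis phi_le : forall x, nrm (phi x) <= norm_phi * nrm x.
Hypothesis phi_neq0 : exists v, phi v != 0.

Lemma phiB x y : phi (x - y) = phi x - phi y.
Proof. by rewrite phiD -scaleN1r phiZ mulN1r. Qed.

Lemma phi_iterP n a x y : phi (iter n T (a *: x + y)) = a * phi (iter n T x) + phi (iter n T y).
Proof. by rewrite iter_linear phiD phiZ. Qed.

Lemma moment_root_op rs y : moment (fun n => phi (iter n T y)) (root_poly rs) = phi (root_op T rs y).
Proof.
elim: rs y => [|r rs IH] y /=.
  have -> : root_poly [::] = 'X^0 :> {poly C} by rewrite /root_poly big_nil expr0.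
  by rewrite momentXn.
have step i : phi (iter i T (T y - r *: y)) = phi (iter i.+1 T y) - r * phi (iter i T y).
  by rewrite -scaleNr [T y + _]addrC phi_iterP iterSr mulNr addrC.
rewrite root_poly_cons mulrBl momentB [_ * root_poly rs]mulrC -['X]expr1 moment_mulXn mul_polyC momentZ.
rewrite -IH /moment mulr_sumr -sumrB; apply: eq_bigr => i _.
by rewrite mulrCA -mulrBr addn1 step.
Qed.

Variable x : X.
Hypothesis dense_orbit : forall y e, 0 < e -> exists n, nrm (iter n T x - y) < e.

(** Along the orbit such a functional takes the values [r ^+ n * psi x], whose
    modulus is monotone in [n], whereas they should be dense. *)
Lemma no_eigenfunctional (psi : X -> C) (B : R) r : 0 < B ->
    (forall x y, psi (x + y) = psi x + psi y) -> (forall c x, psi (c *: x) = c * psi x) ->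
    (forall x, nrm (psi x) <= B * nrm x) -> (exists v, psi v != 0) ->
  ~ (forall v, psi (T v) = r * psi v).
Proof.
move=> B0 psiD psiZ psi_le [v psi_v] eig.
have orb n : psi (iter n T x) = r ^+ n * psi x.
  by elim: n => [|n IH]; rewrite ?mul1r //= eig IH exprS mulrA.
have close c e : 0 < e -> exists n, nrm (r ^+ n * psi x - c) < e.
  move=> e0; have [n h] := dense_orbit ((c / psi v) *: v) (divr_gt0 e0 B0).
  exists n; rewrite -orb.
  have -> : c = psi ((c / psi v) *: v) by rewrite psiZ divfK.
  rewrite -[psi _ - _]/(_ + - _) -mulN1r -psiZ -psiD scaleN1r.
  by apply: le_lt_trans (psi_le _) _; rewrite mulrC -ltr_pdivlMr.
set p := psi x in orb close.
have [r1|r1] := leP (nrm r) 1.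
  have [n] := close ((nrm p + 2)%:C%C) 1 ltr01; apply/negP; rewrite -leNgt.
  have h1 : nrm (r ^+ n * p) <= nrm p.
    by rewrite nrmM nrmX ler_piMl ?nrm_ge0 // exprn_ile1 ?nrm_ge0.
  have := nrm_triangle (r ^+ n * p) ((nrm p + 2)%:C%C) 0.
  rewrite !subr0 nrm_real ger0_norm ?addr_ge0 ?nrm_ge0 // nrm_distC; lra.
have [p0|p_neq0] := eqVneq p 0.
  have half_gt0 : 0 < 2^-1 :> R by rewrite invr_gt0.
  have [n] := close 1 2^-1 half_gt0.
  by rewrite p0 mulr0 sub0r nrmN nrm1 ltNge invf_le1 ?ler1n.
have p_gt0 : 0 < nrm p by rewrite lt_neqAle nrm_ge0 andbT eq_sym; apply: contraNneq p_neq0 => /nrm_eq0->.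
have [n] := close 0 (nrm p) p_gt0; apply/negP; rewrite -leNgt subr0 nrmM nrmX.
by rewrite ler_peMl ?nrm_ge0 // exprn_ege1 // ltW.
Qed.

Lemma root_op_linear rs : linear (root_op T rs).
Proof.
elim: rs => [|r rs IH] a y z //=.
rewrite -IH; congr root_op; rewrite linearP scalerBr !scalerDr opprD !scalerA [r * a]mulrC.
by rewrite addrACA.
Qed.

Lemma root_op_bounded rs : exists2 B, 0 < B & forall y, nrm (root_op T rs y) <= B * nrm y.
Proof.
elim: rs => [|r rs [B B0 IH]]; first by exists 1 => // y; rewrite mul1r.
have c0 : 0 < norm_T + nrm r by have := nrm_ge0 r; have := norm_T_ge1; lra.
exists (B * (norm_T + nrm r)) => [|y]; first by rewrite mulr_gt0.
apply: le_trans (IH _) _; rewrite -mulrA ler_wpM2l ?(ltW B0) //.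
by apply: le_trans (nrmB _ _) _; rewrite mulrDl nrmZ lerD2r T_le.
Qed.

(** If [phi] vanished on the range of [(T - r) g(T)] then [phi o g(T)] would be an
    eigenfunctional. *)
Lemma phi_root_op_neq0 rs : exists v, phi (root_op T rs v) != 0.
Proof.
elim: rs => [|r rs IH] //; apply/not_existsP => none.
have [B B0 wB] := root_op_bounded rs.
apply: (@no_eigenfunctional (fun v => phi (root_op T rs v)) (norm_phi * B) r) => //.
- by rewrite mulr_gt0.
- by move=> y z; have := root_op_linear rs 1 y z; rewrite !scale1r => ->; rewrite phiD.
- move=> c y; have w0 : root_op T rs 0 = 0.
    by have := root_op_linear rs (-1) 0 0; rewrite scaler0 addr0 scaleN1r addNr.
  by have := root_op_linear rs c y 0; rewrite w0 !addr0 => ->; rewrite phiZ.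
- by move=> y; apply: le_trans (phi_le _) _; rewrite -mulrA ler_wpM2l ?(ltW norm_phi_gt0).
move=> v; have /negP/negPn/eqP := none v; rewrite /=.
rewrite [T v - _]addrC -scaleNr (root_op_linear rs (- r) v (T v)) phiD phiZ mulNr addrC.
by move=> /eqP; rewrite subr_eq0 => /eqP.
Qed.

(** A dependence between the functionals [phi o T ^ t] would be a monic polynomial
    [a] with [phi o a(T) = 0]; it splits into linear factors, which contradicts
    [phi_root_op_neq0]. *)
Lemma interpolation W (s : nat -> C) : exists y, forall t, (t < W)%N -> phi (iter t T y) = s t.
Proof.
elim: W s => [|W IH] s; first by exists 0.
have [e eP] := choice (fun j : nat => IH (fun t => (t == j)%:R)).
pose a : {poly C} := 'X^W - \sum_(j < W) phi (iter W T (e j)) *: 'X^j.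
have sz_sum : (size (\sum_(j < W) phi (iter W T (e j)) *: 'X^j)%R <= W)%N.
  rewrite -(poly_def W (fun j => phi (iter W T (e j)))); exact: size_poly.
have lead_a : lead_coef a = 1.
  by rewrite /a lead_coefDl ?lead_coefXn // size_polyN size_polyXn ltnS.
have [rs aE] := closed_field_poly_normal a; rewrite lead_a scale1r in aE.
have [v v_neq0] := phi_root_op_neq0 rs.
rewrite -moment_root_op /root_poly -aE /a momentB momentXn moment_sum in v_neq0.
pose v' := v - \sum_(j < W) phi (iter j T v) *: e j.
pose gamma := phi (iter W T v) - \sum_(j < W) phi (iter W T (e j)) * phi (iter j T v).
have gamma_neq0 : gamma != 0.
  apply: contraNneq v_neq0 => g0; rewrite -[X in _ == X]g0 /gamma; apply/eqP; congr (_ - _).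
  by apply: eq_bigr => j _; rewrite momentZ momentXn.
have phi_sum t : phi (iter t T v') = phi (iter t T v) - \sum_(j < W) phi (iter j T v) * phi (iter t T (e j)).
  rewrite /v'; have phi0 : phi (iter t T 0) = 0.
    by have := phi_iterP t (-1) 0 0; rewrite scaler0 addr0 mulN1r addNr.
  rewrite -scaleN1r addrC phi_iterP mulN1r addrC; congr (_ - _).
  elim/big_rec2: _ => [|j b c _ <-]; first by [].
  by rewrite phi_iterP.
have low t : (t < W)%N -> phi (iter t T v') = 0.
  move=> lt_t; rewrite phi_sum (bigD1 (Ordinal lt_t)) //= (eP t t lt_t) eqxx mulr1.
  rewrite big1 ?addr0 ?subrr // => j /eqP ne_j; rewrite (eP j t lt_t).
  by case: eqP => [E|_]; rewrite ?mulr0 //; case: ne_j; apply: val_inj.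
have high : phi (iter W T v') = gamma.
  by rewrite phi_sum /gamma; congr (_ - _); apply: eq_bigr => j _; rewrite mulrC.
have [y0 y0P] := IH s.
exists (((s W - phi (iter W T y0)) / gamma) *: v' + y0) => t.
rewrite phi_iterP ltnS leq_eqVlt => /orP[/eqP ->|lt_t].
  by rewrite high divfK // subrK.
by rewrite low // mulr0 add0r y0P.
Qed.
End Dynamics.

Section RareVisits.
Variable R : realType.
Local Notation C := R[i].
Variable X : completeNormedModType C.
Variable T : {linear X -> X}.
Variable norm_T : R.
Hypothesis norm_T_ge2 : 2 <= norm_T.
Hypothesis T_le : op_bound T norm_T.
Variable phi : X -> C.
Hypothesis phiD : forall x y, phi (x + y) = phi x + phi y.
Hypothesis phiZ : forall c x, phi (c *: x) = c * phi x.
Variable norm_phi : R.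
Hypothesis norm_phi_gt0 : 0 < norm_phi.
Hypothesis phi_le : forall x, nrm (phi x) <= norm_phi * nrm x.
Hypothesis phi_neq0 : exists v, phi v != 0.
Variable x : X.
Hypothesis dense_orbit : forall y e, 0 < e -> exists n, nrm (iter n T x - y) < e.
Variable ws : seq C.
Hypothesis ws_unimodular : forall z, z \in ws -> nrm z = 1.
Hypothesis phi_decay : forall eta, 0 < eta -> exists J B, 0 <= B /\ forall k y,
  nrm (phi (root_op T (nseq (J * k) 0 ++ flatten (nseq k ws)) y)) <= B * eta ^+ k * nrm y.

(** The ball consists of vectors [z] such that [phi (T ^ t z)] follows the sign
    pattern; [approximate_pattern_visits] bounds the number of visits in the
    window from [J * k] to [(J + h) * k] by a multiple of [k] that does not depend
    on [h]. *)
Lemma rare_visits : exists y r, 0 < r /\ forall e, (0 < e)%N -> exists A0, forall n,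
  (e * count (fun n => (nrm (iter n T x - y) < r)%R) (iota 0 n) <= A0 + n)%N.
Proof.
set m := size ws; move WE : (pattern_length m) => W.
have [y yP] := interpolation norm_T_ge2 T_le phiD phiZ norm_phi_gt0 phi_le phi_neq0 dense_orbit W (target R m).
have norm_T0 := norm_T_ge0 norm_T_ge2; have norm_T1 := norm_T_ge1 norm_T_ge2.
have D0 : 0 < 2 * (norm_phi * norm_T ^+ W) by rewrite !mulr_gt0 // exprn_gt0 // (lt_le_trans ltr01).
pose r := (2 * (norm_phi * norm_T ^+ W))^-1; have r0 : 0 < r by rewrite invr_gt0.
exists y, r; split => // e e0.
have near_target z t : (t < W)%N -> nrm (z - y) < r -> nrm (phi (iter t T z) - target R m t) < 2^-1.
  move=> lt_t zy; rewrite -(yP t lt_t) -(phiB phiD phiZ).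
  have -> : iter t T z - iter t T y = iter t T (z - y).
    by have := iter_linear T t (-1) y z; rewrite !scaleN1r ![- _ + _]addrC => ->.
  apply: le_lt_trans (phi_le _) _.
  apply: le_lt_trans (ler_wpM2l (ltW norm_phi_gt0) (iter_le norm_T_ge2 T_le t (z - y))) _.
  apply: (@le_lt_trans _ _ (norm_phi * (norm_T ^+ W * nrm (z - y)))).
    by rewrite !ler_wpM2l ?(ltW norm_phi_gt0) // ler_wpM2r ?nrm_ge0 // ler_weXn2l // ltnW.
  have zy' : nrm (z - y) * (2 * (norm_phi * norm_T ^+ W)) < 1 by rewrite -ltr_pdivlMr // mul1r.
  have -> : norm_phi * (norm_T ^+ W * nrm (z - y)) = nrm (z - y) * (2 * (norm_phi * norm_T ^+ W)) / 2 by field.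
  by rewrite ltr_pdivrMr // mulVf.
pose c := ((W.+1 * (2 * m.+1 * m.+1).+1))%N.
apply: (@sublinear_count _ c) => // h h0.
(* The error [eta ^+ k], multiplied by the growth [norm_T ^+ (h * k)] of the orbit
   along the window, is then [2 ^ (- k)]. *)
pose eta := (2 * norm_T ^+ h)^-1.
have BTh : 0 < norm_T ^+ h by rewrite exprn_gt0 // (lt_le_trans ltr01).
have eta0 : 0 < eta by rewrite invr_gt0 mulr_gt0.
have [J [B [B0 decay]]] := phi_decay eta0.
have half01 : 0 <= (2^-1 : R) < 1 by rewrite invr_ge0 ler0n invf_lt1 ?ltr1n.
have half0 : 0 < (2^-1 : R) by rewrite invr_gt0.
have C0 : 0 <= B * nrm x * norm_T ^+ W by rewrite !mulr_ge0 ?nrm_ge0 // exprn_ge0.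
have [k0 small] := geometric_small half01 half0 C0.
exists J, (maxn 1 k0) => k; rewrite geq_max => /andP[k_ge1 k_ge].
pose s n := phi (iter n T (iter (J * k) T x)).
pose ns := [seq n <- iota 0 (h * k) | nrm (iter (J * k + n) T x - y) < r].
have -> : count (fun n => nrm (iter n T x - y) < r) (iota (J * k) (h * k)) = size ns.
  by rewrite -[X in iota X _]addn0 iotaDl count_map size_filter.
pose tau := B * nrm x * eta ^+ k.
have moment_le n : nrm (moment s (root_poly ws ^+ k * 'X^n)) <= tau * norm_T ^+ n.
  have -> : moment s (root_poly ws ^+ k * 'X^n) =
      phi (root_op T (nseq (J * k) 0 ++ flatten (nseq k ws)) (iter n T x)).
    rewrite -(moment_root_op T phiD phiZ) moment_mulXn.
    have -> : root_poly (nseq (J * k) 0 ++ flatten (nseq k ws)) = root_poly ws ^+ k * 'X^(J * k) :> {poly C}.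
      rewrite -root_poly_nseq /root_poly big_cat mulrC /=; congr (_ * _).
      elim: (J * k)%N => [|N IH]; first by rewrite big_nil expr0.
      by rewrite /= big_cons IH subr0 exprS.
    rewrite moment_mulXn /moment; apply: eq_bigr => i _; congr (_ * phi _).
    by rewrite -!iterD addnAC.
  apply: le_trans (decay k _) _; rewrite /tau.
  have -> : B * nrm x * eta ^+ k * norm_T ^+ n = B * eta ^+ k * (norm_T ^+ n * nrm x) by ring.
  by rewrite ler_wpM2l ?iter_le // mulr_ge0 // exprn_ge0 // ltW.
have tau_small : tau * norm_T ^+ (h * k + W) <= 2^-1.
  apply: le_trans (small k k_ge).
  rewrite /tau exprD exprM.
  have -> : B * nrm x * eta ^+ k * ((norm_T ^+ h) ^+ k * norm_T ^+ W) = B * nrm x * norm_T ^+ W * (eta * norm_T ^+ h) ^+ k.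
    by rewrite exprMn; ring.
  have -> : eta * norm_T ^+ h = 2^-1 by rewrite /eta invfM -mulrA mulVf ?gt_eqF // mulr1.
  by [].
rewrite -WE in tau_small.
apply: leq_trans (approximate_pattern_visits norm_T_ge2 ws_unimodular moment_le tau_small _ _) _.
- by rewrite filter_uniq // iota_uniq.
- move=> n; rewrite mem_filter mem_iota add0n => /andP[ny /= n_lt]; split; first exact: ltnW.
  move=> t; rewrite -/m WE => t_lt; rewrite /s -iterD.
  have -> : (n + t + J * k = t + (J * k + n))%N by rewrite [(n + t)%N]addnC -addnA [(n + _)%N]addnC.
  by rewrite iterD; apply: near_target.
have le1 : ((m * k).+1 <= m.+1 * k)%N by rewrite mulSn -add1n leq_add2r.
have le2 : (2 * m.+1 * (m * k).+1 <= 2 * m.+1 * m.+1 * k)%N.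
  by rewrite -[leqRHS]mulnA leq_mul2l le1 orbT.
rewrite -/m WE /c -[leqRHS]mulnA leq_mul2l /=.
by rewrite [leqRHS]mulSn -add1n leq_add.
Qed.
End RareVisits.

Section Density.
Variable R : realType.
Local Notation C := R[i].

Lemma counting_natr_le (A : pred nat) n :
  (counting ([set (k%:R : C) | k in [set k | A k]] `&` [set z : C | `|z| <= ((n%:R : R)%:C)%C]%R)
    <= ((count A (iota 0 n.+1))%:R)%:E :> \bar R)%E.
Proof.
set S := _ `&` _; pose l := [seq (k%:R : C) | k <- iota 0 n.+1 & A k].
have S_l z : S z -> z \in l.
  move=> [[k /= Ak <-]] /=; rewrite normr_nat -(rmorph_nat (@real_complex_def R (Phant R)) k) lecR ler_nat => le_k.
  by apply/mapP; exists k; rewrite ?rmorph_nat // mem_filter Ak mem_iota add0n ltnS.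
have finS : finite_set S by apply: sub_finite_set (finite_seq l) => z /S_l.
rewrite /counting; case: asboolP => // _; rewrite lee_fin ler_nat -size_filter.
rewrite -(size_map (fun k => k%:R : C)); apply: uniq_leq_size; first exact: fset_uniq.
by move=> z; rewrite in_fset_set // => /set_mem/S_l.
Qed.

Lemma positive_lower_density (A : pred nat) :
    (0 < lower_density [set (k%:R : C) | k in [set k | A k]])%E ->
  exists e N, (0 < e)%N /\ forall n, (N <= n)%N -> (n <= e * count A (iota 0 n.+1))%N.
Proof.
rewrite /lower_density limf_einfE => /ereal_sup_gt[_ [V [M [Mreal MV]] <-]] inf_gt0.
have [d d0 dV] : exists2 d : R, 0 < d & forall r, V r ->
    (d%:E <= counting ([set (k%:R : C) | k in [set k | A k]] `&` [set z : C | `|z| <= (r%:C)%C]%R) * (r^-1)%:E)%E.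
  set I := ereal_inf _ in inf_gt0.
  have I_le r : V r -> (I <= counting ([set (k%:R : C) | k in [set k | A k]] `&` [set z : C | `|z| <= (r%:C)%C]%R) * (r^-1)%:E)%E.
    by move=> Vr; apply: ereal_inf_lbound; exists r.
  case: I inf_gt0 I_le => [d||] //; first by rewrite lte_fin => d0 h; exists d.
  by move=> _ h; exists 1 => // r /h; rewrite leye_eq => /eqP ->; rewrite leey.
pose e := (Num.bound d^-1).+1; pose N := (Num.bound `|M|).+1.
exists e, N; split => // n le_n.
have n0 : 0 < (n%:R : R) by rewrite ltr0n (leq_trans _ le_n).
have Vn : V n%:R.
  apply: MV; apply: le_lt_trans (ler_norm M) _.
  by apply: lt_le_trans (archi_boundP (normr_ge0 M)) _; rewrite ler_nat ltnW.
have := dV _ Vn; set c := count A _.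
have ni : (0 <= (n%:R^-1 : R)%:E)%E by rewrite lee_fin invr_ge0 ltW.
move=> /le_trans/(_ (lee_wpmul2r ni (counting_natr_le A n))); rewrite -/c -EFinM lee_fin.
rewrite ler_pdivlMr // => dn.
have de : d^-1 < e%:R.
  by apply: lt_trans (archi_boundP _) _; rewrite ?invr_ge0 ?(ltW d0) // ltr_nat.
rewrite -(ler_nat R) natrM; apply: (@le_trans _ _ (d^-1 * c%:R)).
  by rewrite mulrC ler_pdivlMr // mulrC.
by rewrite ler_wpM2r // ltW.
Qed.

(** A frequently hypercyclic vector would visit the ball of [rare_visits] with
    positive lower density. *)
Lemma not_frequently_hypercyclic (X : completeNormedModType C) (T : {linear X -> X})
    (K : set C) (ws : seq C) k0 :
    bounded_operator T -> K k0 ->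
    (exists2 F : set C, closed F & K = spectrum T `&` F) ->
    (exists2 G : set C, open G & K = spectrum T `&` G) ->
    (forall k, K k -> nrm k <= 1) -> (forall z, z \in ws -> nrm z = 1) ->
    (forall z, K z -> nrm z = 1 -> z \in ws) ->
  ~ frequently_hypercyclic T.
Proof.
move=> /bounded_operatorP[M M0 TM] Kk0 [F clF KF] [G opG KG] K_disk ws1 wsK [x x_fhc].
pose norm_T := M + 2; have norm_T_ge2 : 2 <= norm_T by rewrite /norm_T; lra.
have T_le : op_bound T norm_T.
  by move=> y; apply: le_trans (TM y) _; rewrite ler_wpM2r ?nrm_ge0 // /norm_T; lra.
have K_spec : K `<=` spectrum T by rewrite KF => z [].
have K_closed z : ~ K z -> exists2 r, 0 < r & forall w, nrm (w - z) < r -> ~ K w.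
  move=> nKz; have [rz|sz] := pselect (resolvent_set T z).
    have [_ _ [M1 M10 Mz]] := resolventP rz; exists (2 * M1)^-1; first by rewrite invr_gt0 mulr_gt0.
    move=> w wz /K_spec; apply.
    by have [|] := resolvent_open rz M10 Mz (w := w); rewrite // -ler_pdivlMr // -invfM ltW.
  have nFz : (~` F) z by move=> Fz; apply: nKz; rewrite KF.
  have [r r0 rF] := open_nrm (closed_openC clF) nFz; exists r => // w /rF nFw.
  by rewrite KF => -[].
have K_open z : K z -> exists2 r, 0 < r & forall w, nrm (w - z) < r -> spectrum T w -> K w.
  rewrite KG => -[_ Gz]; have [r r0 rG] := open_nrm opG Gz.
  by exists r => // w /rG Gw sw.
have [phi [[phiD phiZ] [B B0 phi_le] phi_neq0 decay]] :=
  spectral_functional K_spec K_disk K_closed K_open Kk0 wsK.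
have visits y r : 0 < r -> exists e N, (0 < e)%N /\ forall n, (N <= n)%N ->
    (n <= e * count (fun n => (nrm (iter n T x - y) < r)%R) (iota 0 n.+1))%N.
  move=> r0; apply: positive_lower_density.
  have rC0 : 0 < (r%:C)%C by rewrite ltcR.
  have := x_fhc (ball y (r%:C)%C) (ball_open y _) (ex_intro _ y (ballxx _ rC0)).
  congr (_ < lower_density _)%E; congr image; apply/funext => n /=.
  by rewrite ball_nrm // nrm_distC.
have dense y e : 0 < e -> exists n, nrm (iter n T x - y) < e.
  move=> /(visits y)[c [N [_ /(_ N.+1 (leqnSn N)) h]]].
  have : has (fun n => (nrm (iter n T x - y) < e)%R) (iota 0 N.+2).
    by rewrite has_count; move: h; case: (count _ _) => //; rewrite muln0.
  by case/hasP => n _ ?; exists n.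
have [y [r [r0 rare]]] := rare_visits norm_T_ge2 T_le phiD phiZ B0 phi_le phi_neq0 dense ws1 decay.
have [e [N [e0 freq]]] := visits y r r0.
have [|A0 A0P] := rare (2 * e)%N; first by rewrite muln_gt0.
pose n := (N + A0 + 2)%N.
have h1 := freq n; have h2 := A0P n.+1.
have {}h1 := h1 (leq_trans (leq_addr A0 N) (leq_addr 2 _)).
move: h2; rewrite -mulnA => h2.
have : (2 * n <= A0 + n.+1)%N by apply: leq_trans h2; rewrite leq_mul2l h1.
by rewrite /n; lia.
Qed.

Lemma nrm_cis (a : R) : nrm (cis a) = 1.
Proof. by rewrite nrm_def /= cos2Dsin2 sqrtr1. Qed.
End Density.

Theorem corollary1 (R : realType) (X : completeNormedModType R[i])
    (T : {linear X -> X}) (K : set R[i]) (m : nat) (alpha : 'I_m -> R)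
    (hT : bounded_operator T)
    (hcomp : exists2 z, spectrum T z & K = connected_component (spectrum T) z)
    (hclosed : exists2 F : set R[i], closed F & K = spectrum T `&` F)
    (hopen : exists2 G : set R[i], open G & K = spectrum T `&` G)
    (hdisk : K `<=` [set z : R[i] | `|z| <= 1])
    (hA : K `&` @unit_circle R = [set cis (alpha j) | j in [set: 'I_m]]) :
  [/\ (exists (n : nat) (r : R),
         rat_independent (fun j => alpha j * n%:R + r)) ->
      ~ frequently_hypercyclic T,
      (forall c : 'I_m -> int,
         \sum_(j < m) c j = 0 -> \sum_(j < m) (c j)%:~R * alpha j = 0 ->
         forall j, c j = 0) ->
      ~ frequently_hypercyclic T,
      (K `&` @unit_circle R #<= `I_2)%card ->
      ~ frequently_hypercyclic T
    & (forall j, exists q : rat, alpha j / pi = ratr q) ->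
      ~ frequently_hypercyclic T].
Proof.
suff not_fhc : ~ frequently_hypercyclic T by split.
have [z0 sz0 KE] := hcomp.
have Kz0 : K z0 by rewrite KE; exact: connected_component_refl.
apply: (@not_frequently_hypercyclic _ _ T K [seq cis (alpha j) | j <- enum 'I_m] z0) => //.
- by move=> k /hdisk /=; rewrite normE lecR.
- by move=> _ /mapP[j _ ->]; exact: nrm_cis.
move=> z Kz z1; have : (K `&` @unit_circle R) z by split => //=; rewrite /unit_circle /= normE z1.
by rewrite hA => -[j _ <-]; apply: map_f; rewrite mem_enum.
Qed.
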